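(* Let $p\geq 2$ be an integer and let $G$ be a planar graph. Then $\mathrm{id}^{\leq p}(G)\leq \left\lceil\frac{|E(G)|}{\lfloor p/2\rfloor}\right\rceil + 8\lfloor p/2\rfloor - 8$. In particular, every planar graph $G$ of order $n\ge 3$ satisfies $\mathrm{id}^{\leq p}(G)\le \left\lceil\frac{3n-6}{\lfloor p/2\rfloor}\right\rceil + 8\lfloor p/2\rfloor - 8$.
   Context: All graphs are finite and simple. For an oriented graph $D$ and a set $X\subseteq V(D)$, the inversion of $X$ reverses the orientation of every arc with both endvertices in $X$. For an integer $p\ge 2$, a $(\leq p)$-inversion is the inversion of a set of at most $p$ vertices. For a graph $G$, $\mathrm{id}^{\leq p}(G)$ (the $(\leq p)$-inversion diameter) is the maximum, over all ordered pairs $(\vec G_1,\vec G_2)$ of orientations of $G$ (on the same labelled vertex set), of the minimum number of $(\leq p)$-inversions whose successive application transforms $\vec G_1$ into $\vec G_2$. *)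

(* Defs.v *)
From mathcomp Require Import all_boot.
From Stdlib Require Import Reals.

Set Implicit Arguments.
Unset Strict Implicit.
Unset Printing Implicit Defensive.

Definition simple_graph (T : finType) (e : rel T) : Prop :=
  symmetric e /\ irreflexive e.

Definition nedges (T : finType) (e : rel T) : nat :=
  #|[set [set x.1; x.2] | x in [set x : T * T | e x.1 x.2]]|.

Definition is_orientation (T : finType) (e : rel T) (o : rel T) : Prop :=
  forall x y, (o x y -> e x y) /\ (e x y -> o x y = ~~ o y x).

Definition invert (T : finType) (X : {set T}) (o : rel T) : rel T :=
  fun x y => if (x \in X) && (y \in X) then o y x else o x y.

Definition invert_seq (T : finType) (Xs : seq {set T}) (o : rel T) : rel T :=
  foldl (fun o' X => invert X o') o Xs.

Definition inv_diam_le (T : finType) (e : rel T) (p k : nat) : Prop :=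
  forall o1 o2 : rel T, is_orientation e o1 -> is_orientation e o2 ->
    exists Xs : seq {set T},
      size Xs <= k /\ all (fun X : {set T} => #|X| <= p) Xs /\
      forall x y, invert_seq Xs o1 x y = o2 x y.

Local Open Scope R_scope.

Definition in01 (t : R) : Prop := 0 <= t <= 1.

Definition cont01 (f : R -> R) : Prop :=
  forall t, in01 t -> forall eps, 0 < eps -> exists delta, 0 < delta /\
    forall s, in01 s -> Rabs (s - t) < delta -> Rabs (f s - f t) < eps.

Definition jordan_arc (g : R -> R * R) : Prop :=
  cont01 (fun t => fst (g t)) /\ cont01 (fun t => snd (g t)) /\
  (forall s t, in01 s -> in01 t -> g s = g t -> s = t).

Definition plane_embedding (T : finType) (e : rel T)
    (pos : T -> R * R) (arc : T -> T -> R -> R * R) : Prop :=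
  (forall u v, pos u = pos v -> u = v) /\
  (forall u v, e u v ->
     jordan_arc (arc u v) /\ arc u v 0 = pos u /\ arc u v 1 = pos v /\
     (forall t, in01 t -> arc v u t = arc u v (1 - t))) /\
  (forall u v w t, e u v -> 0 < t < 1 -> arc u v t <> pos w) /\
  (forall u v x y s t, e u v -> e x y -> [set u; v] <> [set x; y] ->
     in01 s -> in01 t -> arc u v s = arc x y t ->
     exists w, arc u v s = pos w).

Definition planar (T : finType) (e : rel T) : Prop :=
  exists pos arc, @plane_embedding T e pos arc.

(* Main.v *)
Require Import Defs.
From Stdlib Require Import Reals Lra Btauto ClassicalEpsilon.
From Coquelicot Require Compactness.
From mathcomp Require Import all_boot zify.

Set Implicit Arguments.
Unset Strict Implicit.
Unset Printing Implicit Defensive.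

(** Write [q] for the half of [p] rounded down and [m] for the number of edges.
    If [D] is the edge set of an induced star forest with [q] edges, then every
    subset of [D] is the edge set of the subgraph induced by at most [2q] vertices.
    Hence one inversion corrects the edges of [D] after the graph without [D] has
    been dealt with, and it suffices to peel off large induced star forests.

    A large induced star forest comes from a maximum matching, enlarged to a star
    forest: contracting the stars gives a graph that is again 5-degenerate, and one
    of the six classes of a colouring of it consists of pairwise non-adjacent stars.
    This yields [m + 6 <= 39 j], where [j] is the size of a largest induced star
    forest, which is enough for an induction on [q].

    The bound [m <= 3n - 6] is obtained from arcs that are merely continuous through
    a parity invariant (the mod 2 van Kampen obstruction). Let [C z u v] be the
    parity of the number of times the arc [uv], seen from the vertex [z], crosses the
    horizontal ray to the right of [z], and let [h x y] tell whether [x] lies above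
    [y]. For two edges [uv] and [xy] without common end, the vector from one arc to
    the other never vanishes on the parameter square, so the crossings along the
    boundary of the square cancel; this is a linear relation modulo 2 between values
    of [C] and [h]. Such a system of relations passes to subgraphs and to
    contractions and is contradictory for [K5], so Mader's argument for graphs
    without [K5] minor applies. *)

Local Infix "^^" := xorb (at level 50, left associativity).

(** * The parity relation of a planar drawing *)

Definition parity_obstruction_free (T : finType) (e : rel T) : Prop :=
  exists (h : T -> T -> bool) (C : T -> T -> T -> bool),
    (forall x y, x != y -> h y x = ~~ h x y) /\
    forall u v x y, e u v -> e x y -> u != x -> u != y -> v != x -> v != y ->
      C u x y ^^ C v x y ^^ C x u v ^^ C y u v
      ^^ h u x ^^ h u y ^^ h v x ^^ h v y = false.

Fixpoint xsum (n : nat) (f : nat -> bool) : bool :=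
  if n is n'.+1 then xsum n' f ^^ f n' else false.

Lemma eq_xsum n f g : (forall i, i < n -> f i = g i) -> xsum n f = xsum n g.
Proof.
elim: n => [//|n IH] fg /=; rewrite fg // IH // => i lt_in.
by apply: fg; rewrite ltnS ltnW.
Qed.

Lemma xsum_xorb n f g : xsum n (fun i => f i ^^ g i) = xsum n f ^^ xsum n g.
Proof. by elim: n => [//|n IH] /=; rewrite IH; btauto. Qed.

Lemma xsum_telescope n (f : nat -> bool) :
  xsum n (fun i => f i ^^ f i.+1) = f 0 ^^ f n.
Proof. by elim: n => [|n IH] /=; [|rewrite IH]; btauto. Qed.

(** Discrete Stokes formula modulo 2: [H] and [V] are the horizontal and vertical sides of unit
    squares, and in the sum over all squares each inner side occurs twice. *)
Lemma xsum_grid (H V : nat -> nat -> bool) m n :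
  (forall a b, a < m -> b < n ->
     H a b ^^ H a b.+1 ^^ V a b ^^ V a.+1 b = false) ->
  xsum m (H^~ 0) ^^ xsum m (H^~ n) ^^ xsum n (V 0) ^^ xsum n (V m) = false.
Proof.
elim: m => [|m IH] sq /=; first by btauto.
have row : H m 0 ^^ H m n = xsum n (V m) ^^ xsum n (V m.+1).
  rewrite -xsum_telescope -xsum_xorb; apply: eq_xsum => b lt_bn.
  have := sq m b (leqnn _) lt_bn.
  by case: (H m b); case: (H m b.+1); case: (V m b); case: (V m.+1 b).
have {}IH := IH (fun a b lt_am => sq a b (leqW lt_am)).
suff comb a b c d x y z : a ^^ b ^^ x ^^ z = false -> c ^^ d = z ^^ y ->
    a ^^ c ^^ (b ^^ d) ^^ x ^^ y = false by apply: comb IH row.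
by case: a b c d x y z => [] [] [] [] [] [] [].
Qed.

(** * Vectors in the plane and crossings of a ray *)

Local Open Scope R_scope.

Definition vec (a b : R * R) : R * R := (fst b - fst a, snd b - snd a).

Definition ltRb (a b : R) : bool := if Rlt_dec a b then true else false.

Lemma ltRbP a b : reflect (a < b) (ltRb a b).
Proof. by rewrite /ltRb; case: Rlt_dec => ab; constructor. Qed.

(** The positive x-axis counts as upper and the negative one as lower, so that opposite nonzero
    vectors always lie on different sides. *)
Definition upper (w : R * R) : bool :=
  ltRb 0 (snd w) || (~~ ltRb (snd w) 0 && ltRb 0 (fst w)).

(* For two vectors in a common open half-plane bounded by a coordinate axis,
   this tells whether the segment between them crosses the positive x-axis. *)
Definition crosses (v w : R * R) : bool := (upper v ^^ upper w) && ltRb 0 (fst v).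

(** The four open half-planes cover the plane without the origin, and only number 0 meets the
    positive x-axis. *)
Definition axis_side (k : 'I_4) (w : R * R) : Prop :=
  match val k with
  | 0%N => 0 < fst w | 1%N => fst w < 0 | 2%N => 0 < snd w | _ => snd w < 0
  end.

Lemma upper_opp a b : a <> b -> upper (vec b a) = ~~ upper (vec a b).
Proof.
case: a b => [a1 a2] [b1 b2] neq_ab; rewrite /upper /vec /=.
case: (ltRbP 0 (a2 - b2)); case: (ltRbP 0 (b2 - a2));
  case: (ltRbP (a2 - b2) 0); case: (ltRbP (b2 - a2) 0);
  case: (ltRbP 0 (a1 - b1)); case: (ltRbP 0 (b1 - a1)) => //=; try lra.
move=> *; case: neq_ab; congr pair; lra.
Qed.

Lemma crosses_sameside k v w : axis_side k v -> axis_side k w ->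
  crosses v w = (val k == 0%N) && (upper v ^^ upper w).
Proof.
case: k v w => [[|[|[|[|//]]]] ?] [v1 v2] [w1 w2];
  rewrite /axis_side /crosses /upper /= => Hv Hw;
  repeat case: ltRbP => //=; try lra.
Qed.

(** Within one half-plane [crosses] is either zero or the change of [upper], so its sum around a
    closed square vanishes. *)
Lemma crosses_square k u v w z :
  axis_side k u -> axis_side k v -> axis_side k w -> axis_side k z ->
  crosses u v ^^ crosses w z ^^ crosses u w ^^ crosses v z = false.
Proof.
move=> ku kv kw kz; rewrite !(crosses_sameside (k := k)) //.
by case: eqP => _ /=; btauto.
Qed.

(** Negation exchanges the two halves of the x-axis, so the two crossing counts add up to the
    crossings of the whole axis, which is the change of [upper]. *)
Lemma crosses_opp k a b a' b' :
  axis_side k (vec a b) -> axis_side k (vec a' b') ->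
  crosses (vec b a) (vec b' a') =
  crosses (vec a b) (vec a' b') ^^ upper (vec b a) ^^ upper (vec b' a').
Proof.
case: k => [[|[|[|[|//]]]] ?]; case: a b a' b' => [a1 a2] [b1 b2] [c1 c2] [d1 d2];
  rewrite /axis_side /crosses /upper /vec /= => Hv Hw;
  repeat case: ltRbP => //=; try lra.
Qed.

Lemma axis_side_exists a b : a <> b -> exists k, axis_side k (vec a b).
Proof.
case: a b => [a1 a2] [b1 b2] neq_ab.
have [|[|[|[|E]]]] : 0 < b1 - a1 \/ b1 - a1 < 0 \/ 0 < b2 - a2 \/ b2 - a2 < 0
  \/ (a1 = b1 /\ a2 = b2) by lra.
- by exists (@Ordinal 4 0 isT).
- by exists (@Ordinal 4 1 isT).
- by exists (@Ordinal 4 2 isT).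
- by exists (@Ordinal 4 3 isT).
- by case: neq_ab; case: E => -> ->.
Qed.

Lemma cont01_pair (g : R -> R * R) s eps :
  cont01 (fun t => fst (g t)) -> cont01 (fun t => snd (g t)) ->
  in01 s -> 0 < eps -> exists d, 0 < d /\ forall s', in01 s' -> Rabs (s' - s) < d ->
    Rabs (fst (g s') - fst (g s)) < eps /\ Rabs (snd (g s') - snd (g s)) < eps.
Proof.
move=> c1 c2 s01 eps0.
have [d1 [d10 P1]] := c1 _ s01 _ eps0; have [d2 [d20 P2]] := c2 _ s01 _ eps0.
exists (Rmin d1 d2); split; first exact: Rmin_pos.
by move=> s' s'01 lt_d; split; [apply: P1 => //|apply: P2 => //];
  have := Rmin_l d1 d2; have := Rmin_r d1 d2; lra.
Qed.

(** The factor 2 leaves room for a grid step: a node may be almost [d] away from [s], and its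
    neighbour almost another [d]. *)
Lemma axis_side_local (g f : R -> R * R) s t :
  jordan_arc g -> jordan_arc f -> in01 s -> in01 t -> g s <> f t ->
  exists (d : posreal) k, forall s' t', in01 s' -> in01 t' ->
      Rabs (s' - s) < 2 * d -> Rabs (t' - t) < 2 * d ->
      axis_side k (vec (g s') (f t')).
Proof.
move=> [g1 [g2 _]] [f1 [f2 _]] s01 t01 /axis_side_exists[k ks].
(* Half of the coordinate that decides the side: moving each end by less than this keeps the
   sign. *)
pose eps := match val k with
  | 0%N | 1%N => Rabs (fst (f t) - fst (g s)) / 2
  | _ => Rabs (snd (f t) - snd (g s)) / 2 end.
have eps0 : 0 < eps.
  rewrite /eps; case: k {eps} ks => [[|[|[|[|//]]]] ?]; rewrite /axis_side /= => ks;
  by apply: Rdiv_lt_0_compat; [apply: Rabs_pos_lt; lra | lra].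
have [d1 [d10 P1]] := cont01_pair g1 g2 s01 eps0.
have [d2 [d20 P2]] := cont01_pair f1 f2 t01 eps0.
have d0 : 0 < Rmin d1 d2 / 2 by have := Rmin_pos _ _ d10 d20; lra.
exists (mkposreal _ d0), k => s' t' s'01 t'01 /= ds dt.
have [A1 A2] : Rabs (fst (g s') - fst (g s)) < eps /\
    Rabs (snd (g s') - snd (g s)) < eps.
  by apply: P1 => //; have := Rmin_l d1 d2; lra.
have [B1 B2] : Rabs (fst (f t') - fst (f t)) < eps /\
    Rabs (snd (f t') - snd (f t)) < eps.
  by apply: P2 => //; have := Rmin_r d1 d2; lra.
move: A1 A2 B1 B2 ks; rewrite /eps.
case: k {eps eps0 P1 P2} => [[|[|[|[|//]]]] ?]; rewrite /axis_side /vec /=;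
  by rewrite /Rabs; repeat case: Rcase_abs; lra.
Qed.

(** * Subdivision of the parameter square *)

Definition node (N a : nat) : R := INR a / INR N.

Lemma node01 N a : (0 < N)%N -> (a <= N)%N -> in01 (node N a).
Proof.
move=> /ltP/lt_INR /= N0 /leP/le_INR aN; have := pos_INR a => a0.
rewrite /in01 /node; split.
  by apply: Rmult_le_pos => //; left; apply: Rinv_0_lt_compat; lra.
by apply: (Rmult_le_reg_r (INR N)); [lra | field_simplify; lra].
Qed.

(** Lebesgue number argument: compactness of the parameter square turns the local radii into a
    uniform mesh. *)
Lemma axis_side_grid (g f : R -> R * R) :
  jordan_arc g -> jordan_arc f ->
  (forall s t, in01 s -> in01 t -> g s <> f t) ->
  exists N0, forall N, (N0 <= N)%N -> (0 < N)%N ->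
    forall a b, (a < N)%N -> (b < N)%N ->
    exists k, forall i j : bool,
      axis_side k (vec (g (node N (a + i))) (f (node N (b + j)))).
Proof.
move=> Jg Jf disj.
pose good s t (d : posreal) := exists k, forall s' t', in01 s' -> in01 t' ->
      Rabs (s' - s) < 2 * d -> Rabs (t' - t) < 2 * d ->
      axis_side k (vec (g s') (f t')).
(* The radius 1 outside the square is a dummy that makes [delta] a total function. *)
have ex_d s t : exists d : posreal, in01 s -> in01 t -> good s t d.
  have [[s01 t01]|no] := classic (in01 s /\ in01 t); last first.
    by exists (mkposreal 1 Rlt_0_1) => s01 t01; case: no.
  have [d Pd] := axis_side_local Jg Jf s01 t01 (disj _ _ s01 t01).
  by exists d.
pose delta s t := proj1_sig (constructive_indefinite_description _ (ex_d s t)).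
have deltaP s t : in01 s -> in01 t -> good s t (delta s t).
  by rewrite /delta; case: constructive_indefinite_description.
have [d Pd] := Compactness.compactness_value_2d 0 1 0 1 delta.
have [N0 [ltN0 /ltP N0_gt0]] := archimed_cor1 d (cond_pos d).
exists N0 => N leN N_gt0 a b aN bN.
have a01 := node01 N_gt0 (ltnW aN); have b01 := node01 N_gt0 (ltnW bN).
(* Compactness provides a nearby centre only up to double negation; its radius is at least [d],
   which exceeds the mesh. *)
have [u [v [u01 [v01 [du [dv dd]]]]]] := NNPP _ (Pd _ _ a01 b01).
have [k Pk] := deltaP _ _ u01 v01.
have invN : 0 < / INR N < d.
  split; first by apply: Rinv_0_lt_compat; apply: lt_0_INR; apply/ltP.
  apply: Rle_lt_trans ltN0; apply: Rinv_le_contravar; last by apply/le_INR/leP.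
  by apply: lt_0_INR; apply/ltP.
exists k => i j; apply: Pk.
- by apply: node01 => //; case: i; rewrite ?addn1 ?addn0 // ltnW.
- by apply: node01 => //; case: j; rewrite ?addn1 ?addn0 // ltnW.
- suff: 0 <= node N (a + i) - node N a < d.
    by move: du; rewrite /Rabs; repeat case: Rcase_abs; lra.
  by rewrite /node plus_INR; case: i => /=; rewrite /Rdiv; lra.
- suff: 0 <= node N (b + j) - node N b < d.
    by move: dv; rewrite /Rabs; repeat case: Rcase_abs; lra.
  by rewrite /node plus_INR; case: j => /=; rewrite /Rdiv; lra.
Qed.

(** The arc is replaced by the polygon through [N + 1] of its points. *)
Definition crossing_parity (N : nat) (z : R * R) (g : R -> R * R) : bool :=
  xsum N (fun a => crosses (vec z (g (node N a))) (vec z (g (node N a.+1)))).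

(** The grid formula is applied to the vectors from [g] to [f]. Two sides of the square give the
    crossing parities around the ends of [g]; on the other two, the view from an end of [f] is the
    negated vector, whence the terms of [h]. *)
Lemma crossing_parity_disjoint N (g f : R -> R * R) :
  (0 < N)%N ->
  (forall a b, (a < N)%N -> (b < N)%N ->
    exists k, forall i j : bool,
      axis_side k (vec (g (node N (a + i))) (f (node N (b + j))))) ->
  let h a b := upper (vec b a) in
  crossing_parity N (g 0) f ^^ crossing_parity N (g 1) f
  ^^ crossing_parity N (f 0) g ^^ crossing_parity N (f 1) g
  ^^ h (g 0) (f 0) ^^ h (g 0) (f 1) ^^ h (g 1) (f 0) ^^ h (g 1) (f 1) = false.
Proof.
move=> N_gt0 sides h.
have INRN : INR N <> 0 by apply: not_0_INR; lia.
have nd0 : node N 0 = 0 by rewrite /node /= /Rdiv Rmult_0_l.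
have nd1 : node N N = 1 by rewrite /node; field.
pose W a b := vec (g (node N a)) (f (node N b)).
have grid : forall a b, (a < N)%N -> (b < N)%N ->
    crosses (W a b) (W a.+1 b) ^^ crosses (W a b.+1) (W a.+1 b.+1)
    ^^ crosses (W a b) (W a b.+1) ^^ crosses (W a.+1 b) (W a.+1 b.+1) = false.
  move=> a b aN bN; have [k Pk] := sides a b aN bN.
  have := Pk false false; have := Pk false true.
  have := Pk true false; have := Pk true true.
  rewrite !addn0 !addn1 => P11 P10 P01 P00.
  exact: (crosses_square P00 P10 P01 P11).
have {}grid := @xsum_grid (fun a b => crosses (W a b) (W a.+1 b))
                          (fun a b => crosses (W a b) (W a b.+1)) N N grid.
have flip b : (b <= N)%N -> xsum N (fun a => crosses (W a b) (W a.+1 b)) =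
    crossing_parity N (f (node N b)) g
    ^^ (h (g 0) (f (node N b)) ^^ h (g 1) (f (node N b))).
  move=> bN; have := xsum_telescope N (fun a => h (g (node N a)) (f (node N b))).
  rewrite nd0 nd1 => <-; rewrite -xsum_xorb.
  apply: eq_xsum => a aN; rewrite /W /h.
  (* Every row but the first is taken as the far side of the squares before it, which includes the
     row [b = N]. *)
  have [b' [j [b'N ->]]] : exists b' (j : bool), (b' < N)%N /\ b = (b' + j)%N.
    case: b bN => [|b] bN; first by exists 0%N, false.
    by exists b, true; rewrite addn1.
  have [k Pk] := sides a b' aN b'N.
  have := Pk false j; have := Pk true j; rewrite addn0 addn1 => P1 P0.
  rewrite (crosses_opp P0 P1).
  by case: (crosses _ _); case: (upper _); case: (upper _).
move: grid; rewrite (flip 0%N) // (flip N) // nd0 nd1 => grid.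
move: grid; rewrite /crossing_parity /W nd0 nd1 => <-; btauto.
Qed.

(** A common point would be a vertex lying on both arcs, hence an end of both edges. *)
Lemma embedding_arcs_disjoint (T : finType) (e : rel T) pos arc u v x y s t :
  simple_graph e -> plane_embedding e pos arc -> e u v -> e x y ->
  u != x -> u != y -> v != x -> v != y ->
  in01 s -> in01 t -> arc u v s <> arc x y t.
Proof.
move=> [esym _] [inj [ends [int cross]]] euv exy ux uy vx vy s01 t01 E.
have neq : [set u; v] <> [set x; y].
  by move=> /setP/(_ u); rewrite !inE eqxx (negPf ux) (negPf uy).
have [w Ew] := cross _ _ _ _ _ _ euv exy neq s01 t01 E.
have end_of a b r : e a b -> in01 r -> arc a b r = pos w -> w = a \/ w = b.
  move=> eab [r0 r1] Er; have [_ [E0 [E1 _]]] := ends _ _ eab.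
  have [r01|[r0'|r1']] : 0 < r < 1 \/ r = 0 \/ r = 1 by lra.
  - by case: (int _ _ w _ eab r01).
  - by left; apply: inj; rewrite -Er r0' E0.
  - by right; apply: inj; rewrite -Er r1' E1.
have := end_of _ _ _ euv s01 Ew; rewrite E in Ew.
have := end_of _ _ _ exy t01 Ew.
move=> [->|->] [] Z; by move: ux uy vx vy; rewrite Z ?eqxx.
Qed.

Lemma planar_parity (T : finType) (e : rel T) :
  simple_graph e -> planar e -> parity_obstruction_free e.
Proof.
move=> simple [pos [arc emb]].
have [inj [ends [_ _]]] := emb.
pose indep (c : T * T * T * T) := let: (u, v, x, y) := c in
  [&& e u v, e x y, u != x, u != y, v != x & v != y].
pose fine (c : T * T * T * T) N0 := let: (u, v, x, y) := c in
  forall N, (N0 <= N)%N -> (0 < N)%N -> forall a b, (a < N)%N -> (b < N)%N ->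
  exists k, forall i j : bool,
    axis_side k (vec (arc u v (node N (a + i))) (arc x y (node N (b + j)))).
have [N0 N0P] : exists N0 : T * T * T * T -> nat,
    forall c, indep c -> fine c (N0 c).
  apply: (@fin_all_exists _ (fun=> nat) (fun c N0 => indep c -> fine c N0)).
  move=> [[[u v] x] y]; case ic: (indep _); last by exists 0%N.
  move: ic => /and5P[euv exy ux uy /andP[vx vy]].
  have [N0 PN0] := axis_side_grid (proj1 (ends _ _ euv)) (proj1 (ends _ _ exy))
    (fun s t s01 t01 => embedding_arcs_disjoint simple emb euv exy ux uy vx vy s01 t01).
  by exists N0 => _; apply: PN0.
(* One subdivision serves all pairs of edges, since [C] may depend only on a vertex and an edge. *)
pose N := (\max_c N0 c).+1.
exists (fun a b => upper (vec (pos b) (pos a))),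
       (fun z a b => crossing_parity N (pos z) (arc a b)); split.
  by move=> x y xy; apply: upper_opp => /inj E; rewrite E eqxx in xy.
move=> u v x y euv exy ux uy vx vy.
have ic : indep (u, v, x, y) by rewrite /indep euv exy ux uy vx vy.
have leN : (N0 (u, v, x, y) <= N)%N by rewrite leqW // leq_bigmax.
have := crossing_parity_disjoint (ltn0Sn _) (N0P _ ic N leN (ltn0Sn _)).
have [_ [-> [-> _]]] := ends _ _ euv.
by have [_ [-> [-> _]]] := ends _ _ exy.
Qed.

Local Close Scope R_scope.

(** * Contractions and K5 *)

(* Bilinear form of the parity relation, for walks [u -> v] and [x -> y] whose
   crossing parities around a vertex are given by [W] and [Z]. *)
Definition walk_parity (T : finType) (h : T -> T -> bool)
    (u v : T) (W : T -> bool) (x y : T) (Z : T -> bool) : Prop :=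
  Z u ^^ Z v ^^ W x ^^ W y ^^ h u x ^^ h u y ^^ h v x ^^ h v y = false.

Lemma walk_parity_cat (T : finType) (h : T -> T -> bool) u v w W W' x y Z :
  walk_parity h u v W x y Z -> walk_parity h v w W' x y Z ->
  walk_parity h u w (fun z => W z ^^ W' z) x y Z.
Proof.
rewrite /walk_parity => H1 H2.
by rewrite -[RHS]/(false ^^ false) -{1}H1 -H2; btauto.
Qed.

(** Each of the four terms of [h] is negated, and four negations cancel. *)
Lemma walk_parity_sym (T : finType) (h : T -> T -> bool) u v W x y Z :
  (forall x y, x != y -> h y x = ~~ h x y) ->
  u != x -> u != y -> v != x -> v != y ->
  walk_parity h u v W x y Z -> walk_parity h x y Z u v W.
Proof.
rewrite /walk_parity => hN ux uy vx vy H.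
by rewrite (hN _ _ ux) (hN _ _ uy) (hN _ _ vx) (hN _ _ vy) -H; btauto.
Qed.

(** The vertex type stays the same: a class of [c] is represented by its fixed point, and the
    vertices moved by [c] become isolated. *)
Definition contract (T : finType) (c : T -> T) (e : rel T) : rel T :=
  fun a b => [&& a != b, c a == a, c b == b &
    [exists p : T * T, [&& c p.1 == a, c p.2 == b & e p.1 p.2]]].

Lemma contract_simple (T : finType) (c : T -> T) (e : rel T) :
  simple_graph e -> simple_graph (contract c e).
Proof.
move=> [esym eirr]; split; last by move=> x; rewrite /contract eqxx.
have half x y : contract c e x y -> contract c e y x.
  move=> /and4P[xy cx cy /existsP[[p q] /and3P[/= cp cq epq]]].
  rewrite /contract eq_sym xy cx cy; apply/existsP; exists (q, p) => /=.
  by rewrite cp cq esym.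
by move=> x y; apply/idP/idP; apply: half.
Qed.

Lemma parity_sub (T : finType) (e e' : rel T) :
  subrel e' e -> parity_obstruction_free e -> parity_obstruction_free e'.
Proof.
by move=> sub [h [C [hN rel]]]; exists h, C; split=> // u v x y /sub + /sub; apply: rel.
Qed.

(** An edge of the contraction is drawn as a walk of three steps: inside the class of one end,
    across an edge, inside the class of the other. The relation is additive in each walk, and walks
    for edges without common end visit disjoint classes. *)
Lemma parity_contract (T : finType) (c : T -> T) (e : rel T) :
  simple_graph e -> (forall x, c x != x -> e x (c x)) ->
  parity_obstruction_free e -> parity_obstruction_free (contract c e).
Proof.
move=> [esym eirr] ec [h [C [hN rel]]].
(* A step that stays in place crosses nothing, so every walk can be given exactly three steps. *)
pose C0 z u v := if u == v then false else C z u v.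
pose lazy u v := (u == v) || e u v.
have step u v x y : lazy u v -> lazy x y -> u != x -> u != y -> v != x -> v != y ->
    walk_parity h u v (C0^~ u ^~ v) x y (C0^~ x ^~ y).
  rewrite /lazy /C0 /walk_parity => luv lxy ux uy vx vy.
  case: eqVneq luv => [-> _|nuv /= euv]; first by btauto.
  case: eqVneq lxy => [-> _|nxy /= exy]; first by btauto.
  exact: rel.
pose rep a b := odflt (a, b)
  [pick p : T * T | [&& c p.1 == a, c p.2 == b & e p.1 p.2]].
pose W a b z := C0 z a (rep a b).1 ^^ C0 z (rep a b).1 (rep a b).2
                ^^ C0 z (rep a b).2 b.
have lazyc x : lazy x (c x) && lazy (c x) x.
  rewrite /lazy (esym (c x)); case: (eqVneq x (c x)) => //=.
  by rewrite eq_sym => /ec->.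
have repP a b : contract c e a b -> exists x y,
    [/\ W a b = (fun z => C0 z a x ^^ C0 z x y ^^ C0 z y b),
        lazy a x && (c x == a), lazy x y, lazy y b && (c y == b) & c a = a /\ c b = b].
  move=> /and4P[ab /eqP ca /eqP cb /existsP ex].
  exists (rep a b).1, (rep a b).2; rewrite /W /rep.
  case: pickP => [[x y] /= /and3P[/eqP cx /eqP cy exy]|no]; last first.
    by case: ex => p; rewrite no.
  rewrite -cx -cy !eqxx; split=> //.
  - by have /andP[_ ->] := lazyc x.
  - by rewrite /lazy exy orbT.
  - by have /andP[-> _] := lazyc y.
  - by rewrite cx ca cy cb.
have neqc x y : c x != c y -> x != y by apply: contra_neq => ->.
exists h, (fun z a b => W a b z); split=> // a b a' b'.
move=> /repP[x [y [-> /andP[lax /eqP cx] lxy /andP[lyb /eqP cy] [ca cb]]]].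
move=> /repP[x' [y' [-> /andP[lax' /eqP cx'] lxy' /andP[lyb' /eqP cy'] [ca' cb']]]].
move=> aa' ab' ba' bb'.
have walk_step p q : lazy p q -> c p \in [:: a'; b'] -> c q \in [:: a'; b'] ->
  walk_parity h a b (fun z => C0 z a x ^^ C0 z x y ^^ C0 z y b) p q (C0^~ p ^~ q).
  move=> lpq cp cq.
  have sep u : c u \in [:: a; b] -> u != p /\ u != q.
    move: cp cq; rewrite !inE => cp cq cu; split; apply: neqc.
      by case/orP: cu => /eqP->; case/orP: cp => /eqP->.
    by case/orP: cu => /eqP->; case/orP: cq => /eqP->.
  have [ap aq] : a != p /\ a != q by apply: sep; rewrite ca !inE eqxx.
  have [bp bq] : b != p /\ b != q by apply: sep; rewrite cb !inE eqxx orbT.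
  have [xp xq] : x != p /\ x != q by apply: sep; rewrite cx !inE eqxx.
  have [yp yq] : y != p /\ y != q by apply: sep; rewrite cy !inE eqxx orbT.
  have S1 := step a x p q lax lpq ap aq xp xq.
  have S2 := step x y p q lxy lpq xp xq yp yq.
  have S3 := step y b p q lyb lpq yp yq bp bq.
  exact: walk_parity_cat (walk_parity_cat S1 S2) S3.
have walk_step' p q : lazy p q -> c p \in [:: a'; b'] -> c q \in [:: a'; b'] ->
  walk_parity h p q (C0^~ p ^~ q) a b (fun z => C0 z a x ^^ C0 z x y ^^ C0 z y b).
  move=> lpq cp cq; apply: walk_parity_sym (walk_step p q _ _ _) => //; apply: neqc;
  rewrite ?ca ?cb; move: cp cq; rewrite !inE.
  - by case/orP=> /eqP->.
  - by move=> _ /orP[]/eqP->.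
  - by case/orP=> /eqP->.
  - by move=> _ /orP[]/eqP->.
suff: walk_parity h a' b' (fun z => C0 z a' x' ^^ C0 z x' y' ^^ C0 z y' b') a b
       (fun z => C0 z a x ^^ C0 z x y ^^ C0 z y b).
  by move/(walk_parity_sym hN); apply; rewrite eq_sym.
by apply: walk_parity_cat; [apply: walk_parity_cat|]; apply: walk_step' => //;
  rewrite ?ca' ?cb' ?cx' ?cy' !inE eqxx ?orbT.
Qed.

(* Sum of the fifteen relations: every crossing term occurs twice, and the number
   of side terms that have to be reversed is five modulo two. *)
Lemma parity_K5 (T : finType) (e : rel T) (a b c d f : T) :
  parity_obstruction_free e -> uniq [:: a; b; c; d; f] ->
  pairwise e [:: a; b; c; d; f] -> False.
Proof.
move=> [h [C [hN rel]]] /=; rewrite !inE !negb_or !andbT.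
move=> /and4P[/and4P[ab ac ad af] /and3P[bc bd bf] /andP[cd cf] df].
move=> /and4P[/and4P[eab eac ead eaf] /and3P[ebc ebd ebf] /andP[ecd ecf] edf].
have sw (x y : T) : x != y -> y != x by rewrite eq_sym.
have R u v x y : e u v -> e x y -> u != x -> u != y -> v != x -> v != y ->
   walk_parity h u v (fun z => C z u v) x y (fun z => C z x y) by exact: rel.
(* Each edge occurs with its ends always in the same order, so that its terms of [C] cancel
   literally. *)
have := R a b c d eab ecd ac ad bc bd.
have := R a c b d eac ebd ab ad (sw _ _ bc) cd.
have := R a d b c ead ebc ab ac (sw _ _ bd) (sw _ _ cd).
have := R a b c f eab ecf ac af bc bf.
have := R a c b f eac ebf ab af (sw _ _ bc) cf.
have := R a f b c eaf ebc ab ac (sw _ _ bf) (sw _ _ cf).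
have := R a b d f eab edf ad af bd bf.
have := R a d b f ead ebf ab af (sw _ _ bd) df.
have := R a f b d eaf ebd ab ad (sw _ _ bf) (sw _ _ df).
have := R a c d f eac edf ad af cd cf.
have := R a d c f ead ecf ac af (sw _ _ cd) df.
have := R a f c d eaf ecd ac ad (sw _ _ cf) (sw _ _ df).
have := R b c d f ebc edf bd bf cd cf.
have := R b d c f ebd ecf bc bf (sw _ _ cd) df.
have := R b f c d ebf ecd bc bd (sw _ _ cf) (sw _ _ df).
rewrite /walk_parity (hN b c) // (hN b d) // (hN c d) // (hN b f) //.
rewrite (hN c f) // (hN d f) //.

move=> H1 H2 H3 H4 H5 H6 H7 H8 H9 H10 H11 H12 H13 H14 H15.
have {H1 H2 H3 H4 H5 H6 H7 H8 H9 H10 H11 H12 H13 H14 H15} :=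
  f_equal2 xorb H1 (f_equal2 xorb H2 (f_equal2 xorb H3 (f_equal2 xorb H4
    (f_equal2 xorb H5 (f_equal2 xorb H6 (f_equal2 xorb H7 (f_equal2 xorb H8
    (f_equal2 xorb H9 (f_equal2 xorb H10 (f_equal2 xorb H11 (f_equal2 xorb H12
    (f_equal2 xorb H13 (f_equal2 xorb H14 H15))))))))))))).
rewrite [LHS](_ : _ = true); last by btauto.
by [].
Qed.

(** * The edge bound *)

Definition edges (T : finType) (e : rel T) : {set {set T}} :=
  [set [set x.1; x.2] | x in [set x : T * T | e x.1 x.2]].

Definition nbrs (T : finType) (e : rel T) (x : T) : {set T} := [set y | e x y].

Lemma set2_eq (T : finType) (x y a b : T) :
  [set x; y] = [set a; b] -> (x = a /\ y = b) \/ (x = b /\ y = a).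
Proof.
move=> E; have: x \in [set a; b] by rewrite -E set21.
have: y \in [set a; b] by rewrite -E set22.
have: a \in [set x; y] by rewrite E set21.
have: b \in [set x; y] by rewrite E set22.
rewrite !inE => /orP[]/eqP-> /orP[]/eqP-> /orP[]/eqP ? /orP[]/eqP ?; subst; tauto.
Qed.

Lemma edgesP (T : finType) (e : rel T) (f : {set T}) :
  reflect (exists x y, f = [set x; y] /\ e x y) (f \in edges e).
Proof.
apply: (iffP imsetP) => [[[x y]]|[x [y [-> exy]]]].
  by rewrite inE /= => exy ->; exists x, y.
by exists (x, y); rewrite ?inE.
Qed.

Lemma mem_edges (T : finType) (e : rel T) x y :
  symmetric e -> ([set x; y] \in edges e) = e x y.
Proof.
move=> esym; apply/edgesP/idP => [[a [b [/set2_eq[[-> ->]|[-> ->]] //]]]|exy].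
  by rewrite esym.
by exists x, y.
Qed.

Lemma set2_injr (T : finType) (x : T) : injective (fun y => [set x; y]).
Proof. by move=> y z /set2_eq[[]|[->]]. Qed.

Lemma card_edge (T : finType) (e : rel T) f :
  irreflexive e -> f \in edges e -> #|f| = 2.
Proof.
move=> eirr /edgesP[x [y [-> exy]]]; rewrite cards2.
by case: eqVneq exy => [->|]; rewrite ?eirr.
Qed.

Lemma edges_at (T : finType) (e : rel T) x : simple_graph e ->
  [set f in edges e | x \in f] = [set [set x; y] | y in nbrs e x].
Proof.
move=> [esym eirr]; apply/setP=> f; rewrite inE; apply/andP/imsetP.
  move=> [/edgesP[a [b [-> eab]]]]; rewrite !inE => /orP[]/eqP->.
    by exists b; rewrite ?inE.
  by exists a; rewrite ?inE 1?esym // setUC.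
by move=> [y]; rewrite inE => exy ->; rewrite mem_edges // set21.
Qed.

Lemma card_edges_at (T : finType) (e : rel T) x : simple_graph e ->
  #|[set f in edges e | x \in f]| = #|nbrs e x|.
Proof. by move=> ge; rewrite edges_at // card_imset //; apply: set2_injr. Qed.

Lemma handshake (T : finType) (e : rel T) : simple_graph e ->
  \sum_x #|nbrs e x| = 2 * #|edges e|.
Proof.
move=> ge; transitivity (\sum_x \sum_(f in edges e) (x \in f)).
  apply: eq_bigr => x _; rewrite -card_edges_at // -sum1dep_card big_mkcondr.
  by apply: eq_bigr => f _; case: (x \in f).
rewrite exchange_big /= mulnC -sum_nat_const; apply: eq_bigr => f ef.
rewrite -(card_edge ge.2 ef) -sum1_card [RHS]big_mkcond.
by apply: eq_bigr => x _; case: (x \in f).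
Qed.

Definition del_edges (T : finType) (e : rel T) (D : {set {set T}}) : rel T :=
  fun x y => e x y && ([set x; y] \notin D).

Lemma del_edges_simple (T : finType) (e : rel T) D :
  simple_graph e -> simple_graph (del_edges e D).
Proof.
move=> [esym eirr]; split=> [x y|x]; first by rewrite /del_edges esym setUC.
by rewrite /del_edges eirr.
Qed.

Lemma edges_del (T : finType) (e : rel T) D :
  symmetric e -> edges (del_edges e D) = edges e :\: D.
Proof.
move=> esym; apply/setP=> f; rewrite inE; apply/edgesP/andP.
  by move=> [x [y [-> /andP[exy nD]]]]; rewrite mem_edges.
by move=> [nD /edgesP[x [y [E exy]]]]; exists x, y; rewrite /del_edges exy -E.
Qed.

(** Contracting [x] into [a] turns the path from [a] through [x] to [b] into an edge, which
    completes a K5 on the remaining five vertices. *)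
Lemma parity_K6_minus_two_edges (T : finType) (e : rel T) (v a b x y z : T) :
  simple_graph e -> parity_obstruction_free e -> uniq [:: v; a; b; x; y; z] ->
  e a x -> e a y -> e a z -> e b x -> e b y -> e b z -> e y z ->
  e v a -> e v b -> e v y -> e v z -> False.
Proof.
move=> ge pe U ax ay az bx by_ bz yz va vb vy vz; have [esym eirr] := ge.
pose c w := if w == x then a else w.
have cP : forall w, c w != w -> e w (c w).
  by move=> w; rewrite /c; case: (eqVneq w x) => [-> _|]; [rewrite esym | rewrite eqxx].
have pc := parity_contract ge cP pe.
move: U; rewrite /= !inE !negb_or !andbT.
move=> /and5P[/and5P[nva nvb nvx nvy nvz] /and4P[nab nax nay naz]
  /and3P[nbx nby nbz] /andP[nxy nxz] nyz].
have cx : c x = a by rewrite /c eqxx.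
have cid w : w != x -> c w = w by rewrite /c => /negPf->.
have ce p q : p != q -> p != x -> q != x -> e p q -> contract c e p q.
  move=> pq px qx epq; rewrite /contract pq !cid // !eqxx /=.
  by apply/existsP; exists (p, q); rewrite /= !cid // !eqxx.
have cab : contract c e a b.
  rewrite /contract nab !cid // !eqxx /=.
  by apply/existsP; exists (x, b); rewrite /= cx cid // !eqxx esym.
apply: (@parity_K5 _ _ v a b y z pc).
  by rewrite /= !inE !negb_or nva nvb nvy nvz nab nay naz nby nbz nyz.
have [nyx nzx] : y != x /\ z != x by rewrite !(eq_sym _ x).
by rewrite /= cab !ce.
Qed.

(** If the neighbourhood is a clique, it has at least four vertices and yields a K5 with [v].
    Otherwise two non-adjacent neighbours force its size to be five, and both are adjacent to the
    other three. By the previous lemma these three are independent, so they have too few common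
    neighbours with [v]. *)
Lemma dense_nbhd_obstruction (T : finType) (e : rel T) (v : T) :
  simple_graph e -> parity_obstruction_free e -> 0 < #|nbrs e v| <= 5 ->
  (forall u, e v u -> 3 <= #|nbrs e v :&: nbrs e u|) -> False.
Proof.
move=> ge pe /andP[deg_gt0 deg_le5] common; have [esym eirr] := ge.
set N := nbrs e v in deg_gt0 deg_le5 common.
have evw w : w \in N -> e v w by rewrite inE.
have vN : v \notin N by rewrite inE eirr.
have [/forallP clq|] := boolP [forall a, [forall b, (a \in N) && (b \in N) && (a != b) ==> e a b]].
  have [u uN] := card_gt0P deg_gt0.
  have N4 : 4 <= #|N|.
    rewrite (cardsD1 u N) uN add1n ltnS.
    apply: leq_trans (common u _) (subset_leq_card _); first by rewrite inE in uN.
    by apply/subsetP => w; rewrite !inE => /andP[-> ewu]; case: eqVneq ewu => [->|]; rewrite ?eirr.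
  have adj a b : a \in N -> b \in N -> a != b -> e a b.
    by move=> aN bN ab; have /forallP/(_ b)/implyP := clq a; apply; rewrite aN bN.
  have : uniq (enum N) by exact: enum_uniq.
  have : all (mem N) (enum N) by apply/allP => w; rewrite mem_enum.
  rewrite cardE in N4; case: (enum N) N4 => [|a [|b [|c [|d s]]]] //= _.
  move=> /and5P[aN bN cN dN _].
  rewrite !inE !negb_or => /and5P[/and4P[ab ac ad _] /and3P[bc bd _] /andP[cd _] _ _].
  have vn w : w \in N -> v != w by move=> wN; apply: contraNneq vN => ->.
  apply: (@parity_K5 _ _ v a b c d pe).
    by rewrite /= !inE !negb_or !vn // ab ac ad bc bd cd.
  by rewrite /= !evw // !adj.
rewrite negb_forall => /existsP[a]; rewrite negb_forall => /existsP[b].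
rewrite negb_imply -!andbA => /and4P[aN bN ab nab].
have nba : ~~ e b a by rewrite esym.
have rest : #|N :\: [set a; b]| + 2 = #|N|.
  by rewrite -(cardsID [set a; b] N) addnC (setIidPr _) ?cards2 ?ab // subUset !sub1set aN bN.
(* A neighbour that misses another one has at most three candidates left, so it is adjacent to all
   of them. *)
have full u w : u \in N -> w \in N -> u != w -> ~~ e u w -> N :\: [set u; w] = N :&: nbrs e u.
  move=> uN wN uw nuw; apply/eqP; rewrite eq_sym eqEcard; apply/andP; split.
    apply/subsetP=> z; rewrite !inE => /andP[-> euz]; rewrite andbT negb_or.
    by apply/andP; split; apply: contraTneq euz => ->; rewrite ?eirr.
  apply: leq_trans (common u _); last by rewrite inE in uN.
  have : #|N :\: [set u; w]| + 2 = #|N|.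
    by rewrite -(cardsID [set u; w] N) addnC (setIidPr _) ?cards2 ?uw // subUset !sub1set uN wN.
  by lia.
have Na := full a b aN bN ab nab.
have Nb : N :\: [set a; b] = N :&: nbrs e b.
  by rewrite setUC; apply: full; rewrite 1?eq_sym.
have card3 : #|N :\: [set a; b]| = 3.
  have := common a _; rewrite -Na; move: (aN); rewrite inE => -> /(_ isT).
  by lia.
pose R := N :\: [set a; b].
have RP z : z \in R -> [/\ z \in N, e a z, e b z, a != z & b != z].
  move=> zR; have := zR; rewrite {1}/R Na !inE => /andP[zN ->].
  have := zR; rewrite {1}/R Nb !inE => /andP[_ ->].
  by move: zR; rewrite !inE negb_or !(eq_sym z) => /andP[/andP[-> ->]].
have vn w : w \in N -> v != w by move=> wN; apply: contraNneq vN => ->.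
have finish x y z : x \in R -> y \in R -> z \in R -> x != y -> x != z -> y != z -> ~~ e y z.
  move=> /RP[xN ax bx nax nbx] /RP[yN ay by_ nay nby] /RP[zN az bz naz nbz] xy xz yz.
  apply/negP => eyz; apply: (@parity_K6_minus_two_edges _ e v a b x y z ge pe) => //; try exact: evw.
  by rewrite /= !inE !negb_or !vn // ab nax nay naz nbx nby nbz xy xz yz.
have : uniq (enum R) by exact: enum_uniq.
have : all (mem R) (enum R) by apply/allP => w; rewrite mem_enum.
have := cardE R; rewrite card3; case: (enum R) => [|x [|y [|z [|]]]] //= _.
move=> /and4P[xR yR zR _]; rewrite !inE negb_or !andbT => /andP[/andP[xy xz] yz].
have nyz := finish x y z xR yR zR xy xz yz.
have nyx : ~~ e y x by apply: (finish z) => //; rewrite eq_sym.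
have [xN _ _ _ _] := RP x xR; have [yN _ _ _ _] := RP y yR.
have [zN _ _ _ _] := RP z zR.
move/setP: (full y z yN zN yz nyz) => /(_ x).
by rewrite !inE (negPf nyx) andbF (negPf xy) (negPf xz) /=; rewrite inE in xN; rewrite xN.
Qed.

(** The contraction loses the edge [vu] and, for each common neighbour, one of two edges that become
    parallel. *)
Lemma contract_edge_card (T : finType) (e : rel T) (u v : T) :
  simple_graph e -> e v u ->
  #|edges e| <= #|edges (contract (fun x => if x == v then u else x) e)|
                + #|nbrs e v :&: nbrs e u| + 1.
Proof.
move=> ge evu; have [esym eirr] := ge; set c := (fun x : T => _).
have vu : v != u by apply: contraTneq evu => ->; rewrite eirr.
have cu : c u = u by rewrite /c; case: eqP.
have cid x : x != v -> c x = x by rewrite /c => /negPf->.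
have [csym _] := contract_simple c ge.
pose New := nbrs e v :\: (u |: nbrs e u).
pose E0 := [set f in edges e | v \notin f].
have subE : E0 :|: [set [set u; x] | x in New] \subset edges (contract c e).
  apply/subsetP => f; rewrite inE => /orP[].
    rewrite inE => /andP[/edgesP[x [y [-> exy]]]]; rewrite !inE negb_or !(eq_sym v) => /andP[xv yv].
    rewrite mem_edges // /contract !cid // !eqxx /=; apply/andP; split.
      by apply: contraTneq exy => ->; rewrite eirr.
    by apply/existsP; exists (x, y); rewrite /= !cid // !eqxx.
  move=> /imsetP[x]; rewrite !inE negb_or => /andP[/andP[xu nux] evx] ->.
  have xv : x != v by apply: contraTneq evx => ->; rewrite eirr.
  rewrite mem_edges // /contract eq_sym xu cu cid // !eqxx /=.
  by apply/existsP; exists (v, x); rewrite /= (cid x) // /c !eqxx.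
have dis : E0 :&: [set [set u; x] | x in New] = set0.
  apply/setP=> f; rewrite !inE; apply/negbTE/negP => /andP[/andP[ef _] /imsetP[x xN Ef]].
  by move: ef xN; rewrite Ef mem_edges // !inE => ->; rewrite orbT.
have := subset_leq_card subE; rewrite cardsU dis cards0 subn0.
rewrite card_imset; last exact: set2_injr.
have EE : #|edges e| = #|E0| + #|nbrs e v|.
  rewrite -card_edges_at // addnC -(cardsID [set f : {set T} | v \in f] (edges e)); congr (_ + _).
    by apply: eq_card => f; rewrite !inE.
  by apply: eq_card => f; rewrite !inE andbC.
have NN : #|nbrs e v| = #|New| + #|nbrs e v :&: nbrs e u| + 1.
  rewrite -(cardsID (u |: nbrs e u) (nbrs e v)) addnC -addnA; congr (_ + _).
  rewrite setIUr cardsU (_ : nbrs e v :&: [set u] = [set u]); last first.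
    by apply/setIidPr; rewrite sub1set inE.
  rewrite cards1 (_ : [set u] :&: _ = set0) ?cards0; first by lia.
  by apply/setP=> x; rewrite !inE; case: eqP => [->|]; rewrite ?eirr ?andbF.
lia.
Qed.

(** [A] plays the role of the vertex set, since contraction keeps the type. Some vertex has degree
    at most five; each of its edges lies in three triangles, as otherwise contracting it loses at
    most three edges while the bound drops by three. *)
Lemma edge_bound (T : finType) (e : rel T) (A : {set T}) :
  simple_graph e -> parity_obstruction_free e -> (forall x y, e x y -> x \in A) ->
  3 <= #|A| -> #|edges e| + 6 <= 3 * #|A|.
Proof.
move: {2}#|A| (leqnn #|A|) => n; elim: n e A => [|n IHn] e A; first by case: #|A|.
move=> leA; move: {2}#|edges e| (leqnn #|edges e|) => m; elim: m e => [|m IHm] e lem ge pe supp A3.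
  by lia.
have [esym eirr] := ge.
have [E0|[f fE]] := set_0Vmem (edges e); first by rewrite E0 cards0; lia.
(* Removing one edge shows that the bound fails by at most one, which keeps the average degree below
   six. *)
have le1 : #|edges e| + 5 <= 3 * #|A|.
  have cE : #|edges e| = #|edges (del_edges e [set f])| + 1.
    by rewrite edges_del // (cardsD1 f (edges e)) fE addnC.
  suff: #|edges (del_edges e [set f])| + 6 <= 3 * #|A| by lia.
  apply: IHm; [by lia | exact: del_edges_simple | | | by []].
    by apply: parity_sub pe => x y /andP[].
  by move=> x y /andP[/supp].
have edgesA : edges e \subset [set B : {set T} | B \subset A & #|B| == 2].
  apply/subsetP=> g gE; rewrite inE (card_edge eirr gE) eqxx andbT.
  move/edgesP: gE => [x [y [-> exy]]]; rewrite subUset !sub1set (supp _ _ exy).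
  by rewrite esym in exy; rewrite (supp _ _ exy).
have := subset_leq_card edgesA; rewrite cards_draws => leC.
have [A4|A5] := leqP #|A| 4.
  have [A3'|A4'] : #|A| = 3 \/ #|A| = 4 by lia.
    by move: leC; rewrite A3' (_ : 'C(3, 2) = 3) //; lia.
  by move: leC; rewrite A4' (_ : 'C(4, 2) = 6) //; lia.
rewrite leqNgt; apply/negP => gt.
have [v vA deg5] : exists2 v, v \in A & #|nbrs e v| <= 5.
  apply/exists_inP; rewrite -[X in is_true X]negbK negb_exists_in; apply/negP => /forall_inP all6.
  have := handshake ge; have : 6 * #|A| <= \sum_x #|nbrs e x|.
    rewrite (bigID (mem A)) /= mulnC -sum_nat_const; apply: leq_trans (leq_addr _ _).
    by apply: leq_sum => x xA; rewrite ltnNge all6.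
  by lia.
have suppD (e' : rel T) : (forall x y, e' x y -> x \in A :\ v) -> simple_graph e' ->
    parity_obstruction_free e' -> #|edges e'| + 6 <= 3 * #|A :\ v|.
  move=> supp' ge' pe'; apply: IHn => //; rewrite (cardsD1 v A) vA in leA A5.
    by lia.
  by lia.
rewrite (cardsD1 v A) vA in suppD gt A5 *.
have [deg0|deg_gt0] := posnP #|nbrs e v|.
  have := suppD e; suff supp' : forall x y, e x y -> x \in A :\ v by move=> /(_ supp' ge pe); lia.
  move=> x y exy; rewrite !inE (supp _ _ exy) andbT; apply: contraTneq exy => ->.
  by move/cards0_eq/setP/(_ y): deg0; rewrite !inE => ->.
apply: (@dense_nbhd_obstruction _ e v) => //; first by rewrite deg_gt0.
move=> u evu; rewrite leqNgt; apply/negP => common2.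
have uA : u \in A by rewrite esym in evu; apply: supp evu.
have vu : v != u by apply: contraTneq evu => ->; rewrite eirr.
pose c x := if x == v then u else x.
have := suppD (contract c e); have := contract_edge_card ge evu; rewrite -/c => H1 H2.
have: #|edges (contract c e)| + 6 <= 3 * #|A :\ v|.
  apply: H2; [|exact: contract_simple|].
    move=> x y /and4P[xy cx cy /existsP[[p q] /and3P[/= /eqP cp cq epq]]].
    rewrite !inE; move: cx; rewrite /c.
    case: (eqVneq x v) => [->|_ _] /=; first by rewrite eq_sym (negPf vu).
    by move: cp; rewrite /c; case: (eqVneq p v) => _ <- //; apply: supp epq.
  apply: parity_contract => // x; rewrite /c.
  by case: (eqVneq x v) => [->|]; rewrite ?eqxx.
by lia.
Qed.

(** * Induced star forests *)

(** Among at most six vertices any one will do; beyond that, the edge bound makes the average degree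
    inside [A] less than six. *)
Lemma low_degree (T : finType) (e : rel T) (A : {set T}) :
  simple_graph e -> parity_obstruction_free e -> A != set0 ->
  exists2 v, v \in A & #|nbrs e v :&: A| <= 5.
Proof.
move=> [esym eirr] pe /set0Pn[a aA]; have [A6|A7] := leqP #|A| 6.
  exists a => //; rewrite (cardsD1 a A) aA ltnS in A6; apply: leq_trans A6.
  apply/subset_leq_card/subsetP => x; rewrite !inE => /andP[eax ->].
  by rewrite andbT; apply: contraTneq eax => ->; rewrite eirr.
pose eA x y := [&& e x y, x \in A & y \in A].
have gA : simple_graph eA.
  by split=> [x y|x]; rewrite /eA ?eirr // esym; congr (_ && _); rewrite andbC.
have pA : parity_obstruction_free eA by apply: parity_sub pe => x y /andP[].
have supp x y : eA x y -> x \in A by case/and3P.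
have := edge_bound gA pA supp (leq_trans (isT : 3 <= 7) A7); have := handshake gA.
move=> hs eb; apply/exists_inP; rewrite -[X in is_true X]negbK negb_exists_in.
apply/negP => /forall_inP deg6.
have : 6 * #|A| <= \sum_x #|nbrs eA x|.
  rewrite (bigID (mem A)) /= mulnC -sum_nat_const; apply: leq_trans (leq_addr _ _).
  apply: leq_sum => x xA; rewrite ltnNge.
  rewrite (_ : nbrs eA x = nbrs e x :&: A) ?deg6 //.
  by apply/setP=> y; rewrite !inE /eA xA.
by lia.
Qed.

Lemma six_coloring (T : finType) (e : rel T) :
  simple_graph e -> parity_obstruction_free e ->
  exists k : T -> 'I_6, forall x y, e x y -> k x != k y.
Proof.
move=> ge pe; have [esym eirr] := ge.
suff [k kP] : exists k : T -> 'I_6,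
    forall x y, x \in [set: T] -> y \in [set: T] -> e x y -> k x != k y.
  by exists k => x y; apply: kP; rewrite inE.
move: {2}#|_| (leqnn #|[set: T]|) => n; elim: n [set: T] => [|n IH] A leA.
  exists (fun=> ord0) => x y xA; move: leA; rewrite leqn0 cards_eq0 => /eqP A0.
  by rewrite A0 inE in xA.
have [->|A0] := eqVneq A set0; first by exists (fun=> ord0) => x y; rewrite inE.
have [v vA deg5] := low_degree ge pe A0.
have [|k kP] := IH (A :\ v); first by rewrite (cardsD1 v) vA in leA; lia.
have [i iP] : exists i, i \notin k @: (nbrs e v :&: A).
  apply/existsP; rewrite -[X in is_true X]negbK negb_exists; apply/negP => /forallP full.
  have : #|'I_6| <= #|k @: (nbrs e v :&: A)|.
    by apply/subset_leq_card/subsetP => i _; have := full i; rewrite negbK.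
  rewrite card_ord; have := leq_imset_card k (nbrs e v :&: A); lia.
have iv y : y \in A -> e v y -> i != k y.
  by move=> yA evy; apply: contraNneq iP => ->; apply: imset_f; rewrite !inE evy.
exists (fun x => if x == v then i else k x) => x y xA yA exy.
case: (eqVneq x v) => [xv|xv]; case: (eqVneq y v) => [yv|yv].
- by rewrite xv yv eirr in exy.
- by apply: iv; rewrite // -xv.
- by rewrite eq_sym; apply: iv; rewrite // -yv esym.
- by apply: kP; rewrite ?inE ?xv ?yv.
Qed.

(* Pairwise separation of [D] means that the edges of [D] form an induced star forest. *)
Definition separated (T : finType) (e : rel T) (f g : {set T}) : bool :=
  [forall x in f, forall y in g, e x y ==> ([set x; y] == f) || ([set x; y] == g)].

Definition induced_stars (T : finType) (e : rel T) (D : {set {set T}}) : bool :=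
  (D \subset edges e) && [forall f in D, forall g in D, separated e f g].

Lemma separatedP (T : finType) (e : rel T) (f g : {set T}) :
  reflect (forall x y, x \in f -> y \in g -> e x y -> [set x; y] = f \/ [set x; y] = g)
          (separated e f g).
Proof.
apply: (iffP forall_inP) => [sep x y xf yg exy|sep x xf].
  have /forall_inP/(_ y yg) := sep x xf.
  by rewrite exy => /orP[]/eqP; [left | right].
apply/forall_inP => y yg; apply/implyP => exy.
by case: (sep x y xf yg exy) => ->; rewrite eqxx ?orbT.
Qed.

Lemma induced_starsP (T : finType) (e : rel T) (D : {set {set T}}) :
  reflect ((forall f, f \in D -> f \in edges e) /\
           forall f g, f \in D -> g \in D -> separated e f g) (induced_stars e D).
Proof.
apply: (iffP andP) => [[/subsetP sub /forall_inP sep]|[sub sep]]; split=> //.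
- by move=> f g fD; have /forall_inP := sep f fD; apply.
- exact/subsetP.
- by apply/forall_inP => f fD; apply/forall_inP => g gD; apply: sep.
Qed.

Lemma separated_refl (T : finType) (e : rel T) f :
  irreflexive e -> f \in edges e -> separated e f f.
Proof.
move=> eirr /edgesP[a [b [-> eab]]]; apply/separatedP => x y.
rewrite !inE => /orP[]/eqP-> /orP[]/eqP->; rewrite ?eirr // => _; first by left.
by left; rewrite setUC.
Qed.

(** [c] sends the leaves of each star to its centre and fixes all other vertices. In a 6-colouring
    of the contraction, stars of one colour are non-adjacent, the last hypothesis excludes edges
    between leaves of one star, and some colour has a sixth of the leaves. *)
Lemma star_map_bound (T : finType) (e : rel T) (c : T -> T) :
  simple_graph e -> parity_obstruction_free e ->
  (forall x, c (c x) = c x) -> (forall x, c x != x -> e x (c x)) ->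
  (forall x y, c x != x -> c y != y -> c x = c y -> ~~ e x y) ->
  exists2 D, induced_stars e D & #|[set x | c x != x]| <= 6 * #|D|.
Proof.
move=> ge pe cK ec leaf; have [esym eirr] := ge.
have [k kP] := six_coloring (contract_simple c ge) (parity_contract ge ec pe).
set M := [set x | c x != x].
have [i iP] : exists i, #|M| <= 6 * #|[set x in M | k (c x) == i]|.
  apply/existsP; rewrite -[X in is_true X]negbK negb_exists; apply/negP => /forallP small.
  have : \sum_(i < 6) (6 * #|[set x in M | k (c x) == i]|).+1 <= \sum_(i < 6) #|M|.
    by apply: leq_sum => i _; rewrite ltnNge.
  rewrite sum_nat_const card_ord; under eq_bigr do rewrite -addn1.
  rewrite big_split /= sum_nat_const card_ord -big_distrr /=.
  suff -> : \sum_(i < 6) #|[set x in M | k (c x) == i]| = #|M| by lia.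
  rewrite -sum1_card (partition_big (fun x => k (c x)) predT) //=.
  by apply: eq_bigr => i _; rewrite sum1dep_card.
exists [set [set x; c x] | x in [set x in M | k (c x) == i]]; last first.
  rewrite card_in_imset // => x y; rewrite !inE => /andP[Mx _] /andP[My _].
  by move=> /set2_eq[[]//|[xE _]]; move: Mx; rewrite xE cK eqxx.
apply/induced_starsP; split=> [f /imsetP[x]|f g /imsetP[x xM ->] /imsetP[y yM ->]].
  by rewrite !inE => /andP[Mx _] ->; rewrite mem_edges // ec.
move: xM yM; rewrite !inE => /andP[Mx /eqP kx] /andP[My /eqP ky].
apply/separatedP => s t sf tg est.
have cs : c s = c x by move: sf; rewrite !inE => /orP[]/eqP->; rewrite ?cK.
have ct : c t = c y by move: tg; rewrite !inE => /orP[]/eqP->; rewrite ?cK.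
have [cxy|cxy] := eqVneq (c x) (c y); last first.
  have : contract c e (c x) (c y).
    rewrite /contract cxy !cK !eqxx /=; apply/existsP; exists (s, t).
    by rewrite /= cs ct !eqxx.
  by move/kP; rewrite kx ky eqxx.
move: sf tg est; rewrite !inE -cxy => /orP[]/eqP-> /orP[]/eqP->; rewrite ?eirr //.
- by move=> exy; have := leaf x y Mx My cxy; rewrite exy.
- by left.
- by right; rewrite setUC.
Qed.

(** * Maximum matchings and short augmenting paths *)

Definition matching (T : finType) (e : rel T) (f : T -> T) : Prop :=
  (forall x, f (f x) = x) /\ (forall x, f x != x -> e x (f x)).

(** A matching is an involution whose fixed points are the unmatched vertices, so the number of
    moved vertices is twice the number of edges. *)
Definition max_matching (T : finType) (e : rel T) (f : T -> T) : Prop :=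
  matching e f /\
  forall g, matching e g -> #|[set x | g x != x]| <= #|[set x | f x != x]|.

Lemma max_matching_exists (T : finType) (e : rel T) : exists f, max_matching e f.
Proof.
pose P (f : {ffun T -> T}) := [forall x, (f (f x) == x) && ((f x != x) ==> e x (f x))].
have PP (f : {ffun T -> T}) : reflect (matching e f) (P f).
  apply: (iffP forallP) => [H|[H1 H2] x]; last by rewrite H1 eqxx; apply/implyP/H2.
  by split=> x; have /andP[/eqP ? /implyP] := H x.
have Pid : P [ffun x => x] by apply/forallP=> x; rewrite !ffunE !eqxx.
case: (@arg_maxnP _ _ P (fun f => #|[set x | f x != x]|) Pid) => f /PP mf fmax.
exists f; split=> // g mg.
have eqg : finfun g =1 g by move=> x; rewrite ffunE.
rewrite (_ : #|_| = #|[set x | finfun g x != x]|); last first.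
  by apply: eq_card => x; rewrite !inE eqg.
apply: fmax; apply/PP; case: mg => g1 g2; split=> x; rewrite !eqg //; exact: g2.
Qed.

(** [V] is closed under [f] and perfectly matched by [pi]; using [pi] instead of [f] inside [V]
    would also cover [u] and enlarge the matching. *)
Lemma no_rematching (T : finType) (e : rel T) (f : T -> T) 
    (V : {set T}) (pi : T -> T) (u : T) :
  simple_graph e -> max_matching e f ->
  (forall z, z \in V -> [/\ f z \in V, pi z \in V, pi (pi z) = z & e z (pi z)]) ->
  u \in V -> f u = u -> False.
Proof.
move=> [esym eirr] [[fK fe] fmax] VP uV fu.
pose g z := if z \in V then pi z else f z.
have gm : matching e g.
  split=> z; rewrite /g; case: (boolP (z \in V)) => zV.
  - by have [_ -> ->] := VP z zV.
  - rewrite ifN ?fK //; apply: contra zV => fzV.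
    by have [+ _ _ _] := VP _ fzV; rewrite fK.
  - by have [_ _ _ ->] := VP z zV.
  - exact: fe.
have := fmax g gm; rewrite leqNgt => /negP; apply; apply: proper_card.
apply/properP; split.
  apply/subsetP => z; rewrite !inE /g; case: ifP => // zV _.
  by have [_ _ _] := VP z zV; apply: contraTneq => ->; rewrite eirr.
exists u; rewrite !inE ?fu ?eqxx // /g uV.
by have [_ _ _] := VP u uV; apply: contraTneq => ->; rewrite eirr.
Qed.

Lemma unmatched_indep (T : finType) (e : rel T) (f : T -> T) u w :
  simple_graph e -> max_matching e f -> f u = u -> f w = w -> ~~ e u w.
Proof.
move=> ge mf fu fw; apply/negP => euw; have [esym eirr] := ge.
have uw : u != w by apply: contraTneq euw => ->; rewrite eirr.
pose pi z := if z == u then w else u.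
apply: (@no_rematching _ e f [set u; w] pi u); rewrite ?inE ?eqxx //.
move=> z; rewrite !inE /pi => /orP[]/eqP->; rewrite ?fu ?fw !eqxx ?orbT (eq_sym w) (negPf uw) ?eqxx.
  by [].
by rewrite esym.
Qed.

(** The forbidden path is [u], [x], [f x], [w]. *)
Lemma no_augmenting_path3 (T : finType) (e : rel T) (f : T -> T) u w x :
  simple_graph e -> max_matching e f ->
  f u = u -> f w = w -> u != w -> e u x -> ~~ e w (f x).
Proof.
move=> ge mf fu fw uw eux; apply/negP => ewfx; have [esym eirr] := ge.
have [[fK _] _] := mf.
have fx : f x != x by apply: contraTneq eux => fx; apply: (unmatched_indep ge mf).
have ux : u != x by apply: contra_neq fx => <-.
have wx : w != x by apply: contra_neq fx => <-.
have ufx : u != f x by apply: contra_neq fx => E; rewrite -E -{1}fu E fK.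
have wfx : w != f x by apply: contra_neq fx => E; rewrite -E -{1}fw E fK.
pose pi z := if z == u then x else if z == x then u else if z == w then f x else w.
have piu : pi u = x by rewrite /pi eqxx.
have pix : pi x = u by rewrite /pi eq_sym (negPf ux) eqxx.
have piw : pi w = f x by rewrite /pi eq_sym (negPf uw) (negPf wx) eqxx.
have pifx : pi (f x) = w.
  by rewrite /pi !(eq_sym (f x)) (negPf ufx) (negPf wfx) eq_sym (negPf fx).
apply: (@no_rematching _ e f (u |: [set w; x; f x]) pi u); rewrite ?inE ?eqxx //.
move=> z; rewrite !inE -!orbA => /or4P[]/eqP->.
- by rewrite fu piu pix !eqxx ?orbT.
- by rewrite fw piw pifx !eqxx ?orbT.
- by rewrite pix piu esym !eqxx ?orbT.
- by rewrite fK pifx piw esym !eqxx ?orbT.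
Qed.

(** The forbidden path is [u], [f a], [a], [b], [f b], [w]. *)
Lemma no_augmenting_path5 (T : finType) (e : rel T) (f : T -> T) u w a b :
  simple_graph e -> max_matching e f ->
  f u = u -> f w = w -> u != w -> e u (f a) -> e w (f b) -> ~~ e a b.
Proof.
move=> ge mf fu fw uw eua ewb; apply/negP => eab; have [esym eirr] := ge.
have [[fK _] _] := mf.
have fa : f a != a.
  by apply: contraTneq eua => fa; apply: (unmatched_indep ge mf); rewrite ?fK.
have fb : f b != b.
  by apply: contraTneq ewb => fb; apply: (unmatched_indep ge mf); rewrite ?fK.
have ab : a != b by apply: contraTneq eab => ->; rewrite eirr.
(* If [a] were [f b], the path would shorten to [w], [a], [f a], [u]. *)
have afb : a != f b.
  apply: contraTneq ewb => <-; apply: contraTN eua; apply: (no_augmenting_path3 ge mf) => //.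
  by rewrite eq_sym.
have fab : f a != b by apply: contra_neq afb => <-; rewrite fK.
have fafb : f a != f b by apply: contra_neq ab => /(congr1 f); rewrite !fK.
have ua : u != a by apply: contra_neq fa => <-.
have ub : u != b by apply: contra_neq fb => <-.
have wa : w != a by apply: contra_neq fa => <-.
have wb : w != b by apply: contra_neq fb => <-.
have ufa : u != f a by apply: contra_neq fa => E; rewrite -E -{1}fu E fK.
have ufb : u != f b by apply: contra_neq fb => E; rewrite -E -{1}fu E fK.
have wfa : w != f a by apply: contra_neq fa => E; rewrite -E -{1}fw E fK.
have wfb : w != f b by apply: contra_neq fb => E; rewrite -E -{1}fw E fK.
pose pi z := if z == u then f a else if z == f a then u else
  if z == a then b else if z == b then a else if z == w then f b else w.
have piu : pi u = f a by rewrite /pi eqxx.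
have pifa : pi (f a) = u by rewrite /pi eq_sym (negPf ufa) eqxx.
have pia : pi a = b.
  by rewrite /pi eq_sym (negPf ua) eq_sym (negPf fa) eqxx.
have pib : pi b = a.
  by rewrite /pi !(eq_sym b) (negPf ub) (negPf fab) (negPf ab) eqxx.
have piw : pi w = f b.
  by rewrite /pi eq_sym (negPf uw) (negPf wfa) (negPf wa) (negPf wb) eqxx.
have pifb : pi (f b) = w.
  rewrite /pi !(eq_sym (f b)) (negPf ufb) (negPf fafb) (negPf afb) (negPf wfb).
  by rewrite eq_sym (negPf fb).
apply: (@no_rematching _ e f (u |: (w |: [set a; b; f a; f b])) pi u); rewrite ?inE ?eqxx //.
move=> z; rewrite !inE -!orbA => /or4P[/eqP->|/eqP->|/eqP->|/or3P[]/eqP->].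
- by rewrite fu piu pifa !eqxx ?orbT.
- by rewrite fw piw pifb !eqxx ?orbT.
- by rewrite pia pib !eqxx ?orbT.
- by rewrite pib pia esym !eqxx ?orbT.
- by rewrite fK pifa piu esym !eqxx ?orbT.
- by rewrite fK pifb piw esym !eqxx ?orbT.
Qed.

Definition support (T : finType) (e : rel T) : {set T} := [set x | nbrs e x != set0].

(* Stars are grown from a maximum matching by attaching every unmatched vertex
   that has a neighbour whose partner it misses. Each remaining unmatched vertex
   spans triangles with matching edges, and such triangles are pairwise far apart. *)
Lemma support_bound (T : finType) (e : rel T) :
  simple_graph e -> parity_obstruction_free e ->
  exists D1 D2, [/\ induced_stars e D1, induced_stars e D2 &
    #|support e| <= 12 * #|D1| + #|D2|].
Proof.
move=> ge pe; have [esym eirr] := ge.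
have [f mf] := max_matching_exists e; have [[fK fe] _] := mf.
pose good u := (f u == u) && [exists x, e u x && ~~ e u (f x)].
pose att u := odflt u [pick x | e u x && ~~ e u (f x)].
have attP u : good u -> [/\ f u = u, e u (att u), ~~ e u (f (att u)) & f (att u) != att u].
  move=> /andP[/eqP fu /existsP ex]; rewrite /att.
  case: pickP => [x /andP[eux nux]|no]; last by case: ex => x; rewrite no.
  by split=> //=; apply: contraTneq eux => fx; apply: (unmatched_indep ge mf).
pose G := [set att u | u in good].
have GP x : x \in G -> exists2 u, good u & x = att u by move=> /imsetP[u gu ->]; exists u.
have attG u : good u -> att u \in G by move=> gu; apply: imset_f.
(* The two ends of a matching edge cannot both receive attachments, as this would give an augmenting
   path of length three. *)
have Gf x : x \in G -> f x \notin G.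
  move=> /GP[u /attP[fu eux nux fx] xE]; apply/negP => /GP[w /attP[fw ewx nwx _] wE].
  have [uw|uw] := eqVneq u w; first by move: fx; rewrite -xE wE -uw -xE eqxx.
  by have := no_augmenting_path3 ge mf fu fw uw eux; rewrite -xE wE ewx.
(* The centre of a matching edge is the end with attachments if there is one, and otherwise the end
   of smaller rank. *)
pose hub x := if x \in G then x else if f x \in G then f x else
  if enum_rank x < enum_rank (f x) then x else f x.
have hubG x : x \in G -> hub x = x by rewrite /hub => ->.
have hub_f x : hub (f x) = hub x.
  rewrite /hub fK; case: (boolP (x \in G)) => [/Gf/negPf-> //|_].
  case: (f x \in G) => //; have [fx|nfx] := eqVneq (f x) x; first by rewrite fx.
  case: ltngtP => // E; by rewrite (enum_rank_inj (ord_inj E)) eqxx in nfx.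
have hub_or x : hub x = x \/ hub x = f x.
  by rewrite /hub; case: ifP; [left | case: ifP; [right | case: ifP; [left | right]]].
have hubK x : hub (hub x) = hub x by case: (hub_or x) => E; rewrite {1}E ?hub_f.
pose c x := if good x then att x else hub x.
have goodN x : f x != x -> good x = false by rewrite /good => /negPf->.
have hub_good x : good x -> hub x = x.
  by move=> /attP[fx _ _ _]; case: (hub_or x) => ->.
have c_unmatched x : f x = x -> ~~ good x -> c x = x.
  by rewrite /c => fx /negPf->; case: (hub_or x) => ->.
have c_matched x : f x != x -> c x = hub x by rewrite /c => /goodN->.
have hub_moved x : f x != x -> f (hub x) != hub x.
  by case: (hub_or x) => -> //; rewrite fK eq_sym.
have cK x : c (c x) = c x.
  rewrite {2 3}/c; case: (boolP (good x)) => [gx|ngx].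
    by have [_ _ _ m] := attP x gx; rewrite c_matched // hubG // attG.
  have [fx|nfx] := eqVneq (f x) x; last by rewrite c_matched ?hubK ?hub_moved.
  by have -> : hub x = x; [case: (hub_or x) => -> | exact: c_unmatched].
have c_leaf x : c x != x -> (good x /\ c x = att x) \/
    [/\ f x != x, c x = hub x & hub x = f x].
  rewrite /c; case: (boolP (good x)) => [gx _|ngx hx]; first by left.
  right; case: (hub_or x) => E; first by rewrite E eqxx in hx.
  by rewrite E in hx *.
have ec x : c x != x -> e x (c x).
  by move=> /c_leaf[[/attP[_ exa _ _] ->] //|[fx -> ->]]; apply: fe.
have leaf x y : c x != x -> c y != y -> c x = c y -> ~~ e x y.
  move=> /c_leaf[[gx cx]|[fx cx hx]] /c_leaf[[gy cy]|[fy cy hy]]; rewrite cx cy => E.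
  - have [fx _ _ _] := attP x gx; have [fy _ _ _] := attP y gy.
    exact: (unmatched_indep ge mf).
  - by have [_ _ + _] := attP x gx; rewrite E hy fK.
  - by have [_ _ + _] := attP y gy; rewrite -E hx fK esym.
  - by move: E; rewrite hx hy => /(congr1 f); rewrite !fK => ->; rewrite eirr.
have [D1 ind1 le1] := star_map_bound ge pe cK ec leaf.
(* For a [bad] vertex, the partner of a neighbour is again a neighbour. *)
pose bad := [set u in support e | (f u == u) && ~~ good u].
pose nb u := odflt u [pick x | e u x].
have badP u : u \in bad -> [/\ f u = u, e u (nb u), e u (f (nb u)) & f (nb u) != nb u].
  rewrite !inE => /and3P[/set0Pn[x]]; rewrite inE => eux /eqP fu.
  rewrite /good fu eqxx /= negb_exists => /forallP all.
  have eunb : e u (nb u) by rewrite /nb; case: pickP => // /(_ x); rewrite eux.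
  split=> //; first by have := all (nb u); rewrite eunb negbK.
  by apply: contraTneq eunb => fn; apply: (unmatched_indep ge mf).
pose D2 := [set [set u; nb u] | u in bad].
have ind2 : induced_stars e D2.
  have far u w : u \in bad -> w \in bad -> u != w -> ~~ e u (nb w).
    move=> /badP[fu _ _ _] /badP[fw _ ewn _] uw; apply/negP => eun.
    by have := no_augmenting_path3 ge mf fu fw uw eun; rewrite ewn.
  apply/induced_starsP; split=> [g /imsetP[u /badP[_ eun _ _] ->]|].
    by rewrite mem_edges.
  move=> g1 g2 /imsetP[u uB ->] /imsetP[w wB ->].
  have [fu eun eufn _] := badP u uB; have [fw ewn ewfn _] := badP w wB.
  have [<-|uw] := eqVneq u w; first by rewrite separated_refl // mem_edges.
  apply/separatedP => s t; rewrite !inE => /orP[]/eqP-> /orP[]/eqP-> est.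
  - by have := unmatched_indep ge mf fu fw; rewrite est.
  - by have := far u w uB wB uw; rewrite est.
  - by have := far w u wB uB; rewrite eq_sym esym est => /(_ uw).
  - by have := no_augmenting_path5 ge mf fu fw uw eufn ewfn; rewrite est.
have card2 : #|D2| = #|bad|.
  rewrite card_in_imset // => u w /badP[fu _ _ _] /badP[_ _ _ fn] /set2_eq[[]//|[uE _]].
  by rewrite -uE fu eqxx in fn.
exists D1, D2; split=> //; rewrite card2.
(* The factor 12 is 2 times 6: at least half of the matched vertices are leaves, and together with
   the [good] vertices the leaves number at most [6 * #|D1|]. *)
pose matched := [set x | f x != x]; pose Mm := [set x in matched | c x != x].
pose Gd := [set x | good x].
have cover : support e \subset matched :|: Gd :|: bad.
  apply/subsetP=> x sx; have := sx; rewrite !inE => ->.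
  by case: eqP => //= _; case: (good x).
have two : #|matched| <= 2 * #|Mm|.
  have : matched \subset Mm :|: f @: Mm.
    apply/subsetP=> x mx; have := mx; rewrite !inE => fx; rewrite fx /=.
    have [cx|//] := eqVneq (c x) x; rewrite /=.
    rewrite -[x in x \in _]fK; apply: imset_f.
    have ffx : f (f x) != f x by rewrite fK eq_sym.
    by rewrite !inE ffx c_matched // hub_f -c_matched // cx eq_sym.
  move/subset_leq_card; have := cardsU Mm (f @: Mm); have := leq_imset_card f Mm; lia.
have moved : #|Mm| + #|Gd| <= #|[set x | c x != x]|.
  have <- : #|Mm :|: Gd| = #|Mm| + #|Gd|.
    rewrite cardsU (_ : Mm :&: Gd = set0) ?cards0 ?subn0 //.
    by apply/setP=> x; rewrite !inE; case: eqVneq => //= fx; rewrite goodN ?andbF.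
  apply/subset_leq_card/subsetP=> x; rewrite !inE => /orP[/andP[]//|gx].
  have [fx _ _ fa] := attP x gx; rewrite /c gx.
  by apply: contra_neq fa => ->.
have := subset_leq_card cover; have := leq_card_setU (matched :|: Gd) bad.
have := leq_card_setU matched Gd.
move=> [H1 _] [H2 _]; lia.
Qed.

(** If no induced star forest has more than [j] edges, there are at most [13 * j] non-isolated
    vertices, hence at most [39 * j - 6] edges. *)
Lemma induced_stars_lower_bound (T : finType) (e : rel T) (j : nat) :
  simple_graph e -> parity_obstruction_free e -> 0 < j ->
  39 * j - 6 < #|edges e| -> exists2 D, induced_stars e D & j < #|D|.
Proof.
move=> ge pe j0 m_gt; have [esym eirr] := ge.
have supp x y : e x y -> x \in support e.
  by move=> exy; rewrite inE; apply/set0Pn; exists y; rewrite inE.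
have s3 : 3 <= #|support e|.
  have /set0Pn[f fE] : edges e != set0 by rewrite -card_gt0; lia.
  rewrite ltnNge; apply/negP => s2.
  have sub : edges e \subset [set support e].
    apply/subsetP=> g gE; rewrite inE eqEcard (card_edge eirr gE) s2 andbT.
    move/edgesP: gE => [x [y [-> exy]]]; rewrite subUset !sub1set (supp x y) //.
    by rewrite (supp y x) // esym.
  have := subset_leq_card sub; rewrite cards1; lia.
have eb := edge_bound ge pe supp s3.
have [D1 [D2 [i1 i2 le]]] := support_bound ge pe.
have [j1|j1] := ltnP j #|D1|; first by exists D1.
have [j2|j2] := ltnP j #|D2|; first by exists D2.
lia.
Qed.

(* A graph without two separated edges is a complete graph plus isolated vertices. *)
Lemma two_separated_edges (T : finType) (e : rel T) :
  simple_graph e -> parity_obstruction_free e -> 6 < #|edges e| ->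
  exists2 D, induced_stars e D & 1 < #|D|.
Proof.
move=> ge pe m_gt; have [esym eirr] := ge.
have [/existsP[[f g] /and4P[/= fE gE fg sep]]|] :=
  boolP [exists p : {set T} * {set T},
    [&& p.1 \in edges e, p.2 \in edges e, p.1 != p.2 & separated e p.1 p.2]].
  exists [set f; g]; last by rewrite cards2 fg.
  apply/induced_starsP; split=> [h|h1 h2]; first by rewrite !inE => /orP[]/eqP->.
  rewrite !inE => /orP[]/eqP-> /orP[]/eqP-> //; rewrite ?separated_refl //.
  apply/separatedP => x y xg yf exy; move/separatedP: sep => /(_ y x yf xg).
  by rewrite esym setUC => /(_ exy); tauto.
move/existsPn => nosep.
have adj a b x y : e a b -> e x y -> [set a; b] != [set x; y] ->
    ~~ separated e [set a; b] [set x; y].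
  by move=> eab exy neq; have := nosep ([set a; b], [set x; y]); rewrite /= !mem_edges // eab exy neq.
(* Adjacency is transitive, since the two edges of an induced path on three vertices are
   separated. *)
have tr x y z : e x y -> e y z -> x != z -> e x z.
  move=> exy eyz xz; apply: contraT => nxz.
  have neq : [set x; y] != [set y; z].
    by apply/eqP => /set2_eq[[E _]|[E _]]; [rewrite E eirr in exy | rewrite E eqxx in xz].
  have /negP[] := adj _ _ _ _ exy eyz neq; apply/separatedP => s t.
  rewrite !inE => /orP[]/eqP-> /orP[]/eqP->; rewrite ?eirr //; first by left.
    by rewrite (negPf nxz).
  by right.
have /set0Pn[f /edgesP[u [v [_ euv]]]] : edges e != set0 by rewrite -card_gt0; lia.
pose K := u |: nbrs e u.
have clique x y : x \in K -> y \in K -> x != y -> e x y.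
  rewrite !inE => /orP[/eqP->|eux] /orP[/eqP->|euy] xy; rewrite ?eqxx // in xy *.
    by rewrite esym.
  by apply: (tr x u y) => //; rewrite esym.
(* An edge not meeting the clique [K] would be separated from [uv]. *)
have supp x y : e x y -> x \in K.
  move=> exy; apply: contraT; rewrite !inE negb_or => /andP[xu nux].
  have far z s : (z == x) || (z == y) -> (s == u) || (s == v) -> ~~ e s z.
    move=> zxy suv; apply/negP => esz; case/negP: nux.
    have uz : e u z || (u == z).
      case/orP: suv => /eqP sE; first by rewrite -sE esz.
      by case: (eqVneq u z) => [|uz]; rewrite ?orbT // (tr u v z) // -sE.
    case/orP: uz => [uz|/eqP uz].
      case/orP: zxy => /eqP zE; first by rewrite -zE.
      by apply: (tr u z x uz) => //; rewrite 1?esym 1?zE // eq_sym.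
    by case/orP: zxy => /eqP zE; [rewrite -zE uz eqxx in xu | rewrite uz zE esym].
  have neq : [set u; v] != [set x; y].
    apply/eqP => /set2_eq[[E _]|[E1 E2]]; first by rewrite E eqxx in xu.
    by move: nux; rewrite -E2 euv.
  have /negP[] := adj _ _ _ _ euv exy neq; apply/separatedP => s t.
  by rewrite !inE => suv txy est; have := far t s txy suv; rewrite est.
have cE : #|edges e| = 'C(#|K|, 2).
  rewrite -cards_draws; apply: eq_card => g; rewrite !inE; apply/idP/andP.
    move=> gE; rewrite (card_edge eirr gE); split=> //.
    move/edgesP: gE => [x [y [-> exy]]]; rewrite subUset !sub1set (supp _ _ exy).
    by rewrite (supp y x) // esym.
  move=> [gK /cards2P[x [y [xy gE]]]]; rewrite gE mem_edges // clique //.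
    by apply: (subsetP gK); rewrite gE set21.
  by apply: (subsetP gK); rewrite gE set22.
have [K3|K3] := ltnP #|K| 3.
  by move: m_gt; rewrite cE; case: #|K| K3 => [|[|[|]]].
(* More than six edges need a clique on at least five vertices, and from five on ['C(k, 2)] exceeds
   [3 * k - 6]. *)
have := edge_bound ge pe supp K3; rewrite cE.
move: m_gt; rewrite cE bin2; case: #|K| K3 => [|k] // _ /= gt6 le_h.
have hE := odd_double_half (k.+1 * k); rewrite oddM /= andNb add0n in hE.
set h := (k.+1 * k)./2 in gt6 le_h hE.
have k4 : 4 <= k by lia.
exfalso; nia.
Qed.

(** * Inversions *)

(** An edge inside the union of [F] joins two members of [F], and separation makes it one of
    them. *)
Lemma cover_induced_stars (T : finType) (e : rel T) (D F : {set {set T}}) f :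
  induced_stars e D -> F \subset D -> f \in edges e ->
  (f \subset cover F) = (f \in F).
Proof.
move=> /induced_starsP[DE sep] /subsetP FD /edgesP[x [y [-> exy]]].
apply/idP/idP; last exact: bigcup_sup.
rewrite subUset !sub1set => /andP[/bigcupP[g gF xg] /bigcupP[g' gF' yg']].
by have /separatedP/(_ x y xg yg' exy)[->|->] := sep g g' (FD _ gF) (FD _ gF').
Qed.

Lemma subset_of_card (T : finType) (D : {set T}) k :
  k <= #|D| -> exists2 D' : {set T}, D' \subset D & #|D'| = k.
Proof.
move=> leD; exists [set x in take k (enum D)].
  by apply/subsetP => x; rewrite inE => /mem_take; rewrite mem_enum.
rewrite cardsE (card_uniqP _) ?size_take -?cardE; last by rewrite take_uniq ?enum_uniq.
by case: ltngtP leD.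
Qed.

Lemma induced_stars_sub (T : finType) (e : rel T) (D D' : {set {set T}}) :
  D' \subset D -> induced_stars e D -> induced_stars e D'.
Proof.
move=> /subsetP sub /induced_starsP[DE sep]; apply/induced_starsP; split.
  by move=> f /sub /DE.
by move=> f g /sub fD /sub; apply: sep.
Qed.

(* [F] is the set of edges on which the two orientations differ. *)
Definition flippable (T : finType) (e : rel T) (q k : nat) : Prop :=
  forall F : {set {set T}}, exists Xs : seq {set T},
    [/\ size Xs <= k, all (fun X : {set T} => #|X| <= 2 * q) Xs &
        forall f, f \in edges e ->
          odd (count (fun X : {set T} => f \subset X) Xs) = (f \in F)].

(** The quotient is the number of edges over [q], rounded up; [K] is the additive loss. *)
Definition flip_bound (q K : nat) : Prop :=
  forall (T : finType) (e : rel T), simple_graph e -> parity_obstruction_free e ->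
    flippable e q ((#|edges e| + q - 1) %/ q + K).

Lemma flippable_leq (T : finType) (e : rel T) q q' k k' :
  q <= q' -> k <= k' -> flippable e q k -> flippable e q' k'.
Proof.
move=> leq_q leq_k flip F; have [Xs [sz cd par]] := flip F.
exists Xs; split=> //; first exact: leq_trans leq_k.
by apply: sub_all cd => X; lia.
Qed.

(** The extra inversion takes the ends of those edges of [D] whose parity is wrong, and it flips no
    other edge. *)
Lemma flippable_del (T : finType) (e : rel T) (D : {set {set T}}) q k :
  simple_graph e -> induced_stars e D -> #|D| <= q ->
  flippable (del_edges e D) q k -> flippable e q k.+1.
Proof.
move=> [esym eirr] stars leD flip F; have [Xs [sz cd par]] := flip F.
pose wrong := [set f in D | odd (count (fun X : {set T} => f \subset X) Xs) != (f \in F)].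
have wD : wrong \subset D by apply/subsetP => f; rewrite inE => /andP[].
have /induced_starsP[DE _] := stars.
exists (cover wrong :: Xs); split=> //=.
  rewrite cd andbT; apply: leq_trans (leq_card_cover wrong) _.
  rewrite (eq_bigr (fun=> 2)) => [|f]; last first.
    by move=> /(subsetP wD) /DE; apply: card_edge.
  by rewrite sum_nat_const mulnC leq_mul2l /= (leq_trans _ leD) // subset_leq_card.
move=> f fE; rewrite (cover_induced_stars stars wD fE) oddD oddb inE.
have [fD|nfD] := boolP (f \in D) => /=; first by case: (f \in F); case: (odd _).
by apply: par; rewrite edges_del // inE nfD.
Qed.

(** While more than [s] edges remain, one inversion disposes of exactly [q] edges and the rounded
    quotient drops by exactly one. *)
Lemma flip_bound_greedy q s K : 0 < q ->
  (forall (T : finType) (e : rel T), simple_graph e -> parity_obstruction_free e ->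
     s < #|edges e| -> exists2 D, induced_stars e D & q <= #|D|) ->
  (forall (T : finType) (e : rel T), simple_graph e -> parity_obstruction_free e ->
     #|edges e| <= s -> flippable e q ((#|edges e| + q - 1) %/ q + K)) ->
  flip_bound q K.
Proof.
move=> q0 stars small T e.
move: {2}#|edges e| (leqnn #|edges e|) => m; elim: m e => [|m IH] e lem ge pe.
  by apply: small => //; lia.
have [?|gt_s] := leqP #|edges e| s; first exact: small.
have [D0 st0 leD0] := stars T e ge pe gt_s.
have [D subD cD] := subset_of_card leD0; have st := induced_stars_sub subD st0.
have /induced_starsP[DE _] := st.
have cE : #|edges e| = #|edges (del_edges e D)| + q.
  rewrite edges_del; last by case: ge.
  have DsubE : D \subset edges e by apply/subsetP.
  by have := cardsID D (edges e); rewrite (setIidPr DsubE) cD addnC.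
have -> : (#|edges e| + q - 1) %/ q + K = ((#|edges (del_edges e D)| + q - 1) %/ q + K).+1.
  rewrite cE; set m' := #|edges (del_edges e D)|.
  have -> : m' + q + q - 1 = 1 * q + (m' + q - 1) by lia.
  by rewrite divnMDl // add1n addSn.
apply: (flippable_del ge st); first by rewrite cD.
apply: (IH _ _ (del_edges_simple D ge)); first by lia.
by apply: parity_sub pe => x y /andP[].
Qed.

Lemma flip_bound1 : flip_bound 1 0.
Proof.
apply: (flip_bound_greedy (s := 0)) => // T e ge pe; last first.
  rewrite leqn0 cards_eq0 => /eqP E0 F; exists [::]; split=> // f.
  by rewrite E0 inE.
rewrite card_gt0 => /set0Pn[f fE]; exists [set f]; last by rewrite cards1.
apply/induced_starsP; split=> [g|g h]; first by rewrite inE => /eqP->.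
by rewrite !inE => /eqP-> /eqP->; rewrite separated_refl //; case: ge.
Qed.

(** Up to the threshold [s] the inversions for [q] are reused for [q + 1], and [K'] absorbs the
    larger quotient. *)
Lemma flip_bound_step q s K K' : 0 < q ->
  (forall (T : finType) (e : rel T), simple_graph e -> parity_obstruction_free e ->
     s < #|edges e| -> exists2 D, induced_stars e D & q < #|D|) ->
  (forall m, m <= s -> (m + q - 1) %/ q + K <= (m + q.+1 - 1) %/ q.+1 + K') ->
  flip_bound q K -> flip_bound q.+1 K'.
Proof.
move=> q0 stars arith bound; apply: (flip_bound_greedy (s := s)) => // T e ge pe le_s.
exact: flippable_leq (leqnSn q) (arith _ le_s) (bound T e ge pe).
Qed.

(* The constants 3 and 15 bound what is lost while [m <= 6] and [m <= 72]; from
   [q = 4] on, each step from [q] to [q + 1] loses at most 8. *)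
Lemma flip_bound2 : flip_bound 2 3.
Proof.
apply: flip_bound_step (@two_separated_edges) _ flip_bound1 => // m le6.
by rewrite divn1; lia.
Qed.

Lemma flip_bound3 : flip_bound 3 15.
Proof.
(* The thresholds 72 here and 111 below are [39 * j - 6] for [j = 2] and [j = 3]. *)
apply: (flip_bound_step (s := 72)) flip_bound2 => // [T e ge pe gt|m le_s].
  by apply: (induced_stars_lower_bound (j := 2)).
by lia.
Qed.

Lemma flip_bound_large q : flip_bound q.+4 (8 * q.+3).
Proof.
elim: q => [|q IH].
  apply: (flip_bound_step (s := 111)) flip_bound3 => // [T e ge pe gt|m le_s].
    by apply: (induced_stars_lower_bound (j := 3)).
  by lia.
apply: (flip_bound_step (s := 39 * q.+4 - 6)) IH => // [T e ge pe gt|m le_s].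
  by apply: (induced_stars_lower_bound (j := q.+4)).
set a := _ %/ q.+4; set b := _ %/ q.+4.+1.
have ha : a * q.+4 <= m + q.+4 - 1 by apply: leq_trunc_div.
have hb : m + q.+4.+1 - 1 < b.+1 * q.+4.+1 by apply: ltn_ceil.
suff : a <= b + 8 by lia.
rewrite leqNgt; apply/negP => gt_ab.
(* If [a] were at least [b + 9], the limit on [m] would give [b <= 30], whereas comparing [ha] with
   [hb] gives [8 * q.+4 < b], so [b >= 33]. *)
have b30 : b < 31 by nia.
nia.
Qed.

Lemma flip_bound_planar q : 0 < q -> flip_bound q (8 * (q - 1)).
Proof.
case: q => [|[|[|[|q]]]] // _ T e ge pe.
- exact: flip_bound1.
- by apply: flippable_leq (leqnn _) _ (flip_bound2 ge pe); rewrite leq_add2l.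
- by apply: flippable_leq (leqnn _) _ (flip_bound3 ge pe); rewrite leq_add2l.
- by have := flip_bound_large q ge pe; rewrite subn1.
Qed.

(** * From flipped edges to inversions of orientations *)

Lemma invert_seqE (T : finType) (Xs : seq {set T}) (o : rel T) x y :
  invert_seq Xs o x y =
  if odd (count (fun X : {set T} => [set x; y] \subset X) Xs) then o y x else o x y.
Proof.
elim: Xs o x y => [//|X Xs IH] o x y /=.
rewrite IH oddD oddb subUset !sub1set /invert (andbC (y \in X)).
by case: (_ && _); case: (odd _).
Qed.

(** The edges to flip are those on which the orientations differ; on an edge reversal is negation,
    and on other pairs both relations are false. *)
Lemma flippable_inv_diam (T : finType) (e : rel T) q p k :
  simple_graph e -> 2 * q <= p -> flippable e q k -> inv_diam_le e p k.
Proof.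
move=> [esym eirr] le_qp flip o1 o2 or1 or2.
pose differ := [set [set x.1; x.2] | x in [set x : T * T | o1 x.1 x.2 != o2 x.1 x.2]].
have [Xs [sz cd par]] := flip differ.
exists Xs; split=> //; split.
  by apply: sub_all cd => X; lia.
have nonedge o x y : is_orientation e o -> ~~ e x y -> o x y = false.
  by move=> oro ne; apply/negP => /(oro x y).1; rewrite (negPf ne).
have flipb o x y : is_orientation e o -> e x y -> o y x = ~~ o x y.
  by move=> oro exy; rewrite (oro x y).2 // negbK.
move=> x y; rewrite invert_seqE; have [exy|nexy] := boolP (e x y); last first.
  have neyx : ~~ e y x by rewrite esym.
  by rewrite !(nonedge o1) // (nonedge o2) // if_same.
rewrite par ?mem_edges // (flipb o1) //.
have -> : ([set x; y] \in differ) = (o1 x y != o2 x y).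
  apply/imsetP/idP => [[[a b]]|neq]; last by exists (x, y); rewrite ?inE.
  rewrite inE /= => neq /set2_eq[[-> ->] //|[xb ya]].
  rewrite {}xb {}ya in exy *.
  by move: neq; rewrite (flipb o1 b a) // (flipb o2 b a) //; do 2 case: (_ b a).
by case: (o1 x y); case: (o2 x y).
Qed.

Theorem mainTheorem7 :
  forall (p : nat) (T : finType) (e : rel T),
    2 <= p -> simple_graph e -> planar e ->
    inv_diam_le e p ((nedges e + p./2 - 1) %/ p./2 + 8 * p./2 - 8)
    /\ (3 <= #|T| ->
        inv_diam_le e p ((3 * #|T| - 6 + p./2 - 1) %/ p./2 + 8 * p./2 - 8)).
Proof.
move=> p T e p2 ge /(planar_parity ge) pe.
have q0 : 0 < p./2 by lia.
have flip := flip_bound_planar q0 ge pe.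
rewrite -[#|edges e|]/(nedges e) in flip.
have diam k : (nedges e + p./2 - 1) %/ p./2 + 8 * (p./2 - 1) <= k -> inv_diam_le e p k.
  move=> le_k; apply: (flippable_inv_diam (q := p./2)) => //; first by lia.
  exact: flippable_leq (leqnn _) le_k flip.
split=> [|T3]; first by apply: diam; lia.
have T3' : 3 <= #|[set: T]| by rewrite cardsT.
have := edge_bound ge pe (fun x y _ => in_setT x) T3'.
rewrite cardsT -[#|edges e|]/(nedges e) => le_m.
apply: diam; have : (nedges e + p./2 - 1) %/ p./2 <= (3 * #|T| - 6 + p./2 - 1) %/ p./2.
  by apply: leq_div2r; lia.
by lia.
Qed.
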